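(* On $\mathbb{R}^5$ with coordinates $(\theta,\phi,x,q,\psi)$ let $$\omega_1=d\theta-\cos(\psi)\,dx-\sin(\psi)e^{3x}dq,\quad \omega_2=e^{\theta}d\phi+\sin(\psi)\,dx-\cos(\psi)e^{3x}dq,\quad \omega_3=d\psi-e^{\theta}d\phi+3e^{3x}dq,$$ and let $$\tilde g=d\theta^2+e^{2\theta}d\phi^2-\left(dx^2+e^{6x}dq^2\right)-\tfrac12(\omega_1^2+\omega_2^2)+\tfrac16\,\omega_3^2 .$$ Then the coordinate functions $$\mathfrak{r}_1=-e^{\frac{3x}{2}-\frac{\theta}{2}}\sin(\tfrac{\psi}{2})q+\tfrac{1}{3}e^{-\frac{3x}{2}-\frac{\theta}{2}}\cos(\tfrac{\psi}{2}),$$ $$\mathfrak{r}_2=-e^{\frac{3x}{2}-\frac{\theta}{2}}\sin(\tfrac{\psi}{2}),\qquad \mathfrak{r}_3=-\tfrac{1}{3}\phi,$$ $$\mathfrak{r}_4=\left(-\tfrac{1}{6}e^{\frac{3x}{2}-\frac{\theta}{2}}\sin(\tfrac{\psi}{2})q+\tfrac{1}{18}e^{-\frac{3x}{2}-\frac{\theta}{2}}\cos(\tfrac{\psi}{2})\right)\phi-\tfrac{1}{6}e^{\frac{3x}{2}-\frac{3\theta}{2}}\cos(\tfrac{\psi}{2})q-\tfrac{1}{18}e^{-\frac{3x}{2}-\frac{3\theta}{2}}\sin(\tfrac{\psi}{2}),$$ $$\mathfrak{r}_5=\tfrac{1}{6}e^{\frac{3x}{2}}\left(e^{-\frac{3\theta}{2}}\cos(\tfrac{\psi}{2})+\phi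 e^{-\frac{\theta}{2}}\sin(\tfrac{\psi}{2})\right)$$ map the Nurowski conformal structure $[\tilde g]$ of the maximally symmetric rolling distribution $\ker(\omega_1,\omega_2,\omega_3)$ of two hyperboloid surfaces with curvatures in the ratio $1:9$ to the flat metric of Engel $$ds^2=2\,d\mathfrak{r}_1d\mathfrak{r}_5+2\,d\mathfrak{r}_2d\mathfrak{r}_4+d\mathfrak{r}_3^2;$$ precisely, $$ds^2=\tfrac{1}{6}e^{-2\theta}\,\tilde g .$$
   Context: Products of 1-forms are symmetric products, and $\omega^2=\omega\omega$. The rolling distribution is the rank 2 distribution $\ker(\omega_1,\omega_2,\omega_3)$ on the 5-dimensional configuration space (circle twistor bundle) of two surfaces rolling on each other without slipping or twisting; here the two surfaces have metrics $d\theta^2+e^{2\theta}d\phi^2$ (Gauss curvature $-1$) and $dx^2+e^{6x}dq^2$ (Gauss curvature $-9$). It is a $(2,3,5)$-distribution, i.e. a rank 2 distribution $D$ with $[D,D]$ of rank 3 and $[[D,D],D]=TM$. Nurowski's conformal structure is the conformal class of split signature $(2,3)$ metrics canonically associated to a $(2,3,5)$-distribution; for this rolling distribution it is (by a result of An and Nurowski) represented by the metric $\tilde g$ written in the statement. The distribution is called maximally symmetric when this conformal class has vanishing Weyl tensor. In the displayed identity $ds^2$ is understood as pulled back to the coordinates $(\theta,\phi,x,q,\psi)$ through the functions $\mathfrak{r}_i$. *)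

(* Defs.v *)
From HB Require Import structures.
From mathcomp Require Import all_boot all_order all_algebra.
From mathcomp Require Import all_classical all_reals all_analysis.

Set Implicit Arguments.
Unset Strict Implicit.
Unset Printing Implicit Defensive.

Import Order.TTheory GRing.Theory Num.Theory.
Import numFieldNormedType.Exports.

Local Open Scope ring_scope.

Section Calculus.
Variable R : realType.

(* Points of R^5 and tangent vectors share the type 'rV[R]_5.  A covariant
   tensor field takes a point, then its tangent-vector arguments. *)
Let V := 'rV[R]_5.
Let form1 := V -> V -> R.
Let tensor2 := V -> V -> V -> R.

(* C^infinity: all iterated directional derivatives are differentiable *)
Definition smooth (f : V -> R) : Prop :=
  forall (s : seq V) (p : V),
    differentiable (foldr (fun v (h : V -> R) => fun x => 'D_v h x) f s) p.

Definition is_form1 (a : form1) : Prop :=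
  (forall p (c : R) u v, a p (c *: u + v) = c * a p u + a p v) /\
  (forall v, smooth (a ^~ v)).

Definition d (f : V -> R) : form1 := fun p v => 'd f p v.

Definition symprod (a b : form1) : tensor2 :=
  fun p u v => (a p u * b p v + a p v * b p u) / 2.

Definition wedge (a b : form1) : tensor2 :=
  fun p u v => a p u * b p v - a p v * b p u.

(* u and v are extended as constant fields, whose bracket vanishes *)
Definition extd (a : form1) : tensor2 :=
  fun p u v => 'D_u (a ^~ v) p - 'D_v (a ^~ u) p.

Definition coframe (t1 t2 t3 t4 t5 : form1) : Prop :=
  [/\ is_form1 t1, is_form1 t2, is_form1 t3, is_form1 t4 & is_form1 t5] /\
  forall p v, t1 p v = 0 -> t2 p v = 0 -> t3 p v = 0 -> t4 p v = 0 ->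
    t5 p v = 0 -> v = 0.

Definition distribution := V -> V -> Prop.

Definition ker3 (a b c : form1) : distribution :=
  fun p v => [/\ a p v = 0, b p v = 0 & c p v = 0].

Definition section_of (D : distribution) (X : V -> V) : Prop :=
  (forall i, smooth (fun p => X p ord0 i)) /\ forall p, D p (X p).

Definition bracket (X Y : V -> V) (p : V) : V :=
  'D_(X p) Y p - 'D_(Y p) X p.

(* [D, E]: the span at each point (the least row space, every subspace of R^5
   being the row space of a square matrix) of the brackets of sections *)
Definition bracket_dist (D E : distribution) : distribution :=
  fun p v => forall M : 'M[R]_5,
    (forall X Y, section_of D X -> section_of E Y -> (bracket X Y p <= M)%MS) ->
    (v <= M)%MS.

Definition has_rank (D : distribution) (k : nat) : Prop :=
  forall p, exists M : 'M[R]_(k, 5),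
    row_free M /\ forall v : V, D p v <-> (v <= M)%MS.

Definition is_235 (D : distribution) : Prop :=
  [/\ has_rank D 2, has_rank (bracket_dist D D) 3 &
      forall p v, bracket_dist (bracket_dist D D) D p v].

(* The first five of Cartan's structure equations; together with
   D = ker (t1, t2, t3) they single out the adapted coframes of D. *)
Definition cartan_coframe (t1 t2 t3 t4 t5 : form1) : Prop :=
  coframe t1 t2 t3 t4 t5 /\
  exists O1 O2 O3 O4 O5 O6 O7 : form1,
  [/\ is_form1 O1, is_form1 O2, is_form1 O3 & is_form1 O4] /\
  [/\ is_form1 O5, is_form1 O6 & is_form1 O7] /\
  forall p u v,
  [/\ extd t1 p u v =
        wedge t1 (O1 *+ 2 + O4) p u v + wedge t2 O2 p u v + wedge t3 t4 p u v,
      extd t2 p u v =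
        wedge t1 O3 p u v + wedge t2 (O1 + O4 *+ 2) p u v + wedge t3 t5 p u v,
      extd t3 p u v =
        wedge t1 O5 p u v + wedge t2 O6 p u v + wedge t3 (O1 + O4) p u v
        + wedge t4 t5 p u v,
      extd t4 p u v =
        wedge t1 O7 p u v + 4 / 3 * wedge t3 O6 p u v + wedge t4 O1 p u v
        + wedge t5 O2 p u v &
      extd t5 p u v =
        wedge t2 O7 p u v - 4 / 3 * wedge t3 O5 p u v + wedge t4 O3 p u v
        + wedge t5 O4 p u v].

(* g is a metric in Nurowski's conformal class of D *)
Definition nurowski_metric (D : distribution) (g : tensor2) : Prop :=
  exists (t1 t2 t3 t4 t5 : form1) (f : V -> R),
  [/\ cartan_coframe t1 t2 t3 t4 t5,
      forall p v, D p v <-> ker3 t1 t2 t3 p v,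
      smooth f,
      forall p, 0 < f p &
      forall p u v, g p u v =
        f p * (2 * symprod t1 t5 p u v - 2 * symprod t2 t4 p u v
               + 4 / 3 * symprod t3 t3 p u v)].

Section Curvature.
Variable g : tensor2.

Let e (i : 'I_5) : V := delta_mx ord0 i.

Definition gmx (p : V) : 'M[R]_5 := \matrix_(i, j) g p (e i) (e j).

Definition pd (i : 'I_5) (f : V -> R) (p : V) : R := 'D_(e i) f p.

(* Gamma^k_{ij} of the Levi-Civita connection *)
Definition christoffel (k i j : 'I_5) (p : V) : R :=
  2^-1 * \sum_l invmx (gmx p) k l *
    (pd i (fun x => gmx x j l) p + pd j (fun x => gmx x i l) p
     - pd l (fun x => gmx x i j) p).

(* R^l_{kij}, with R(e_i, e_j) e_k = R^l_{kij} e_l *)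
Definition riemann_up (l k i j : 'I_5) (p : V) : R :=
  pd i (christoffel l j k) p - pd j (christoffel l i k) p
  + \sum_m (christoffel l i m p * christoffel m j k p
            - christoffel l j m p * christoffel m i k p).

Definition riemann (l k i j : 'I_5) (p : V) : R :=
  \sum_m gmx p l m * riemann_up m k i j p.

Definition ricci (k j : 'I_5) (p : V) : R := \sum_i riemann_up i k i j p.

Definition scalar_curv (p : V) : R :=
  \sum_i \sum_j invmx (gmx p) i j * ricci i j p.

(* the constants are n - 2 = 3 and (n - 1)(n - 2) = 12 *)
Definition weyl (l k i j : 'I_5) (p : V) : R :=
  riemann l k i j p
  - (gmx p l i * ricci k j p - gmx p l j * ricci k i p
     - gmx p k i * ricci l j p + gmx p k j * ricci l i p) / 3
  + scalar_curv p / 12 * (gmx p l i * gmx p k j - gmx p l j * gmx p k i).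

(* the metric is required to be nondegenerate, so that invmx is the inverse *)
Definition weyl_flat : Prop :=
  forall p, gmx p \in unitmx /\ forall l k i j, weyl l k i j p = 0.

End Curvature.

Definition theta (p : V) : R := p ord0 (inord 0).
Definition phi (p : V) : R := p ord0 (inord 1).
Definition x (p : V) : R := p ord0 (inord 2).
Definition q (p : V) : R := p ord0 (inord 3).
Definition psi (p : V) : R := p ord0 (inord 4).

Definition omega1 : form1 := fun p v =>
  d theta p v - cos (psi p) * d x p v - sin (psi p) * expR (3 * x p) * d q p v.

Definition omega2 : form1 := fun p v =>
  expR (theta p) * d phi p v + sin (psi p) * d x p v
  - cos (psi p) * expR (3 * x p) * d q p v.

Definition omega3 : form1 := fun p v =>
  d psi p v - expR (theta p) * d phi p v + 3 * expR (3 * x p) * d q p v.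

Definition rolling : distribution := ker3 omega1 omega2 omega3.

Definition gtilde : tensor2 := fun p u v =>
  symprod (d theta) (d theta) p u v
  + expR (2 * theta p) * symprod (d phi) (d phi) p u v
  - (symprod (d x) (d x) p u v + expR (6 * x p) * symprod (d q) (d q) p u v)
  - 1 / 2 * (symprod omega1 omega1 p u v + symprod omega2 omega2 p u v)
  + 1 / 6 * symprod omega3 omega3 p u v.

Definition r1 (p : V) : R :=
  - expR (3 * x p / 2 - theta p / 2) * sin (psi p / 2) * q p
  + 1 / 3 * expR (- (3 * x p / 2) - theta p / 2) * cos (psi p / 2).

Definition r2 (p : V) : R :=
  - expR (3 * x p / 2 - theta p / 2) * sin (psi p / 2).

Definition r3 (p : V) : R := - (1 / 3) * phi p.

Definition r4 (p : V) : R :=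
  (- (1 / 6) * expR (3 * x p / 2 - theta p / 2) * sin (psi p / 2) * q p
   + 1 / 18 * expR (- (3 * x p / 2) - theta p / 2) * cos (psi p / 2)) * phi p
  - 1 / 6 * expR (3 * x p / 2 - 3 * theta p / 2) * cos (psi p / 2) * q p
  - 1 / 18 * expR (- (3 * x p / 2) - 3 * theta p / 2) * sin (psi p / 2).

Definition r5 (p : V) : R :=
  1 / 6 * expR (3 * x p / 2) *
  (expR (- (3 * theta p / 2)) * cos (psi p / 2)
   + phi p * expR (- (theta p / 2)) * sin (psi p / 2)).

(* Engel's flat metric, pulled back along (r1, ..., r5) *)
Definition ds2 : tensor2 := fun p u v =>
  2 * symprod (d r1) (d r5) p u v + 2 * symprod (d r2) (d r4) p u v
  + symprod (d r3) (d r3) p u v.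

End Calculus.

(* Main.v *)
From HB Require Import structures.
Require Import Defs.
From mathcomp Require Import all_boot all_order all_algebra.
From mathcomp Require Import all_classical all_reals all_analysis.
From mathcomp Require Import ring lra.
Import Order.TTheory GRing.Theory Num.Theory.
Import numFieldNormedType.Exports.
Local Open Scope ring_scope.

(* The frame fa = d theta, fb = e^theta d phi, fc, fs (the orthonormal coframe
   of the second surface rotated by psi) and fw = omega3 has constant structure
   coefficients:
     d fa = 0, d fb = fa^fb, d fc = (fw + fb)^fs, d fs = - (fw + fb)^fc,
     d fw = 9 fc^fs - fa^fb,
   with omega1 = fa - fc and omega2 = fb - fs.  This makes the growth vector and
   Cartan's structure equations finite linear algebra.  The identity for ds^2 is
   a polynomial identity in half angles and half exponents.  Then gtilde is
   6 exp (2 theta) times the pull-back of a flat metric, and a conformal factor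
   exp (2 f) turns the flat Riemann tensor into the Kulkarni-Nomizu product of
   the metric with a symmetric tensor, whose Weyl part vanishes.  All coefficients are elementary functions, whose derivatives are computed
   formally. *)

(** * Elementary functions on R^5 and their formal derivatives *)

(** The syntax is closed under differentiation along a fixed vector, so smoothness becomes an
    induction on it. It has no inverse: division by a numeral is multiplication by a constant, and
    inverse metrics are supplied as explicit matrices. *)
Inductive elem (R : Type) : Type :=
  | Cst of R
  | Var of 'I_5
  | Add of elem R & elem R
  | Mul of elem R & elem R
  | Opp of elem R
  | Exp of elem R
  | Sin of elem R
  | Cos of elem R.

Arguments Cst {R}.
Arguments Var {R}.
Arguments Add {R}.
Arguments Mul {R}.
Arguments Opp {R}.
Arguments Exp {R}.
Arguments Sin {R}.
Arguments Cos {R}.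

Section Elementary.
Context {R : realType}.
Notation V := 'rV[R]_5.
Implicit Types (e : elem R) (f g h : V -> R) (u v p : V) (c : R).

Fixpoint eval e p : R :=
  match e with
  | Cst c => c
  | Var i => p ord0 i
  | Add e1 e2 => eval e1 p + eval e2 p
  | Mul e1 e2 => eval e1 p * eval e2 p
  | Opp e1 => - eval e1 p
  | Exp e1 => expR (eval e1 p)
  | Sin e1 => sin (eval e1 p)
  | Cos e1 => cos (eval e1 p)
  end.

Fixpoint dv v e : elem R :=
  match e with
  | Cst _ => Cst 0
  | Var i => Cst (v ord0 i)
  | Add e1 e2 => Add (dv v e1) (dv v e2)
  | Mul e1 e2 => Add (Mul (dv v e1) e2) (Mul e1 (dv v e2))
  | Opp e1 => Opp (dv v e1)
  | Exp e1 => Mul (dv v e1) (Exp e1)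
  | Sin e1 => Mul (dv v e1) (Cos e1)
  | Cos e1 => Mul (dv v e1) (Opp (Sin e1))
  end.

Lemma diff_comp_real (h : R -> R) f p v :
  differentiable f p -> derivable h (f p) 1 ->
  differentiable (h \o f) p /\ 'D_v (h \o f) p = 'D_v f p * 'D_1 h (f p).
Proof.
move=> df /derivable1_diffP dh; split; first exact: differentiable_comp.
rewrite deriveE; last exact: differentiable_comp.
by rewrite diff_comp //= deriveE // -derive1E (diff1E dh).
Qed.

Lemma eval_diff e p :
  differentiable (eval e) p /\ forall v, 'D_v (eval e) p = eval (dv v e) p.
Proof.
elim: e => [c|i|e1 [d1 D1] e2 [d2 D2]|e1 [d1 D1] e2 [d2 D2]|
  e [df D]|e [df D]|e [df D]|e [df D]] /=.
- by split=> [|v]; [exact: differentiable_cst | exact: derive_cst].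
- have dc := @differentiable_coord R 1 5 p ord0 i.
  split=> // v; rewrite deriveE //.
  (* A coordinate is packaged as a linear map, so that it is its own differential. *)
  have lin : linear (fun x : V => x ord0 i : R) by move=> a y z; rewrite !mxE.
  pose L := GRing.isLinear.Build R V R _ _ lin.
  pose F : {linear V -> R} := HB.pack (fun x : V => x ord0 i : R) L.
  by rewrite (@diff_lin _ _ _ F p) //; exact: coord_continuous.
- split=> [|v]; first exact: differentiableD.
  by rewrite (_ : (fun _ => _) = eval e1 + eval e2) // deriveD ?D1 ?D2 //;
    exact: diff_derivable.
- split=> [|v]; first exact: differentiableM.
  rewrite (_ : (fun _ => _) = eval e1 * eval e2) // deriveM; try exact: diff_derivable.
  by rewrite D1 D2 /GRing.scale /= addrC [in RHS]mulrC.
- split=> [|v]; first exact: differentiableN.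
  rewrite (_ : (fun _ => _) = - eval e) // deriveN ?D //.
  exact: diff_derivable.
- have dC v := diff_comp_real expR _ _ v df (@derivable_expR R _).
  split=> [|v]; first exact: (dC 0).1.
  by rewrite (dC v).2 D derive_val.
- have dC v := diff_comp_real sin _ _ v df (@derivable_sin R _).
  split=> [|v]; first exact: (dC 0).1.
  by rewrite (dC v).2 D derive_val.
- have dC v := diff_comp_real cos _ _ v df (@derivable_cos R _).
  split=> [|v]; first exact: (dC 0).1.
  by rewrite (dC v).2 D derive_val.
Qed.

Lemma derive_eval e v : (fun p => 'D_v (eval e) p) = eval (dv v e).
Proof. by apply/funext => p; exact: (eval_diff e p).2. Qed.

Definition elementary f : Prop := exists e, f = eval e.

Lemma elementary_smooth f : elementary f -> smooth f.
Proof.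
move=> [e ->] s p; suff [e' ->] : elementary
    (foldr (fun v (h : V -> R) => fun x => 'D_v h x) (eval e) s).
  exact: (eval_diff e' p).1.
elim: s => [|v s [e' IH]] /=; first by exists e.
by exists (dv v e'); rewrite IH derive_eval.
Qed.

Lemma elementary_diff {f} (p : V) : elementary f -> differentiable f p.
Proof. by move=> [e ->]; exact: (eval_diff e p).1. Qed.

Lemma elementary_derivable {f} p v : elementary f -> derivable f p v.
Proof. by move=> ef; apply: diff_derivable; exact: elementary_diff. Qed.

Lemma elementary_cst c : elementary (fun=> c).
Proof. by exists (Cst c). Qed.

Lemma elementaryD {f g} : elementary f -> elementary g ->
  elementary (fun p => f p + g p).
Proof. by move=> [e ->] [e' ->]; exists (Add e e'). Qed.

Lemma elementaryM {f g} : elementary f -> elementary g ->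
  elementary (fun p => f p * g p).
Proof. by move=> [e ->] [e' ->]; exists (Mul e e'). Qed.

Lemma elementaryZ {c f} : elementary f -> elementary (fun p => c * f p).
Proof. by apply: elementaryM; exact: elementary_cst. Qed.

Lemma elementaryN {f} : elementary f -> elementary (fun p => - f p).
Proof.
by move=> [e ->]; exists (Opp e).
Qed.

Lemma elementary_sum {I : Type} {r : seq I} {F : I -> V -> R} :
  (forall i, elementary (F i)) -> elementary (fun p => \sum_(i <- r) F i p).
Proof.
move=> eF; elim: r => [|i r IH].
  by under eq_fun do rewrite big_nil; exact: elementary_cst.
by under eq_fun do rewrite big_cons; exact: elementaryD.
Qed.

Lemma elementary_derive {f} v : elementary f -> elementary (fun p => 'D_v f p).
Proof. by move=> [e ->]; exists (dv v e); rewrite derive_eval. Qed.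

(** Schwarz's theorem without analysis: once the mixed derivatives of the subexpressions agree, both
    orders of formal differentiation give the same polynomial in the subexpressions and their
    derivatives. *)
Lemma elementary_deriveC f u v p : elementary f ->
  'D_u (fun x => 'D_v f x) p = 'D_v (fun x => 'D_u f x) p.
Proof.
move=> [e ->]; rewrite !derive_eval !(eval_diff _ _).2.
by elim: e => //= [e1 -> e2 ->|e1 -> e2 ->|e ->|e ->|e ->|e ->] //; ring.
Qed.

Lemma elementary_dD f g v p : elementary f -> elementary g ->
  'D_v (fun x => f x + g x) p = 'D_v f p + 'D_v g p.
Proof.
by move=> ef eg; rewrite (_ : (fun _ => _) = f + g) // deriveD //;
  exact: elementary_derivable.
Qed.

Lemma elementary_dM f g v p : elementary f -> elementary g ->
  'D_v (fun x => f x * g x) p = 'D_v f p * g p + f p * 'D_v g p.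
Proof.
move=> ef eg; rewrite (_ : (fun _ => _) = f * g) // deriveM;
  try exact: elementary_derivable.
by rewrite /GRing.scale /= addrC mulrC.
Qed.

Lemma elementary_dZ c f v p : elementary f ->
  'D_v (fun x => c * f x) p = c * 'D_v f p.
Proof.
move=> ef; rewrite elementary_dM ?derive_cst ?mul0r ?add0r //.
exact: elementary_cst.
Qed.

Lemma elementary_dN f v p : elementary f ->
  'D_v (fun x => - f x) p = - 'D_v f p.
Proof.
by move=> ef; rewrite (_ : (fun _ => _) = - f) // deriveN //;
  exact: elementary_derivable.
Qed.

Lemma elementary_dsum (I : Type) (r : seq I) (F : I -> V -> R) v p :
  (forall i, elementary (F i)) ->
  'D_v (fun x => \sum_(i <- r) F i x) p = \sum_(i <- r) 'D_v (F i) p.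
Proof.
move=> eF; elim: r => [|i r IH].
  by under eq_fun do rewrite big_nil; rewrite derive_cst big_nil.
under eq_fun do rewrite big_cons.
by rewrite elementary_dD ?IH ?big_cons //; exact: elementary_sum.
Qed.

End Elementary.

(** * Matrix-valued fields and their partial derivatives *)

Section MatrixFields.
Context {R : realType}.
Notation V := 'rV[R]_5.

Definition mx_elementary {m n : nat} (M : V -> 'M[R]_(m, n)) : Prop :=
  forall i j, elementary (fun p => M p i j).

Definition mpd {m n : nat} (i : 'I_5) (M : V -> 'M[R]_(m, n)) (p : V) :
    'M[R]_(m, n) :=
  \matrix_(l, k) pd i (fun x => M x l k) p.

Lemma mx_elementaryM {m n k : nat} {M : V -> 'M[R]_(m, n)}
    {N : V -> 'M[R]_(n, k)} :
  mx_elementary M -> mx_elementary N -> mx_elementary (fun p => M p *m N p).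
Proof.
move=> eM eN i j; under eq_fun do rewrite mxE.
by apply: elementary_sum => l; exact: elementaryM.
Qed.

Lemma mx_elementaryZ {m n : nat} {f : V -> R} {M : V -> 'M[R]_(m, n)} :
  elementary f -> mx_elementary M -> mx_elementary (fun p => f p *: M p).
Proof.
by move=> ef eM i j; under eq_fun do rewrite mxE; exact: elementaryM.
Qed.

Lemma mx_elementaryD {m n : nat} {M N : V -> 'M[R]_(m, n)} :
  mx_elementary M -> mx_elementary N -> mx_elementary (fun p => M p + N p).
Proof.
by move=> eM eN i j; under eq_fun do rewrite mxE; exact: elementaryD.
Qed.

Lemma mx_elementaryT {m n : nat} {M : V -> 'M[R]_(m, n)} :
  mx_elementary M -> mx_elementary (fun p => (M p)^T).
Proof. by move=> eM i j; under eq_fun do rewrite mxE; exact: eM. Qed.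

Lemma mx_elementary_cst {m n : nat} (M : 'M[R]_(m, n)) :
  mx_elementary (fun=> M).
Proof. by move=> i j; exact: elementary_cst. Qed.

Lemma mx_elementary_row {m n : nat} {M : V -> 'M[R]_(m, n)} (i : 'I_m) :
  mx_elementary M -> mx_elementary (fun p => row i (M p)).
Proof. by move=> eM j k; under eq_fun do rewrite mxE; exact: eM. Qed.

Lemma mx_elementary_mpd {m n : nat} {M : V -> 'M[R]_(m, n)} (i : 'I_5) :
  mx_elementary M -> mx_elementary (mpd i M).
Proof.
by move=> eM j k; under eq_fun do rewrite mxE; exact: elementary_derive.
Qed.

Lemma mpdD {m n : nat} (i : 'I_5) (M N : V -> 'M[R]_(m, n)) (p : V) :
  mx_elementary M -> mx_elementary N ->
  mpd i (fun x => M x + N x) p = mpd i M p + mpd i N p.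
Proof.
move=> eM eN; apply/matrixP => j k; rewrite !mxE /pd.
by under eq_fun do rewrite mxE; exact: elementary_dD.
Qed.

Lemma mpdN {m n : nat} (i : 'I_5) (M : V -> 'M[R]_(m, n)) (p : V) :
  mx_elementary M -> mpd i (fun x => - M x) p = - mpd i M p.
Proof.
move=> eM; apply/matrixP => j k; rewrite !mxE /pd.
by under eq_fun do rewrite mxE; exact: elementary_dN.
Qed.

Lemma mpdM {m n k : nat} (i : 'I_5) (M : V -> 'M[R]_(m, n))
    (N : V -> 'M[R]_(n, k)) (p : V) :
  mx_elementary M -> mx_elementary N ->
  mpd i (fun x => M x *m N x) p = mpd i M p *m N p + M p *m mpd i N p.
Proof.
move=> eM eN; apply/matrixP => j l; rewrite !mxE /pd.
under eq_fun do rewrite mxE.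
rewrite elementary_dsum => [|a]; last exact: elementaryM.
rewrite -big_split /=; apply: eq_bigr => a _.
by rewrite elementary_dM // !mxE.
Qed.

Lemma mpdZ {m n : nat} (i : 'I_5) (f : V -> R) (M : V -> 'M[R]_(m, n)) (p : V) :
  elementary f -> mx_elementary M ->
  mpd i (fun x => f x *: M x) p = pd i f p *: M p + f p *: mpd i M p.
Proof.
move=> ef eM; apply/matrixP => j l; rewrite !mxE /pd.
by under eq_fun do rewrite mxE; rewrite elementary_dM.
Qed.

Lemma mpdT {m n : nat} (i : 'I_5) (M : V -> 'M[R]_(m, n)) (p : V) :
  mpd i (fun x => (M x)^T) p = (mpd i M p)^T.
Proof. by apply/matrixP => j l; rewrite !mxE; under eq_fun do rewrite mxE. Qed.

Lemma mpd_row {m n : nat} (i : 'I_5) (j : 'I_m) (M : V -> 'M[R]_(m, n)) (p : V) :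
  mpd i (fun x => row j (M x)) p = row j (mpd i M p).
Proof. by apply/matrixP => k l; rewrite !mxE; under eq_fun do rewrite mxE. Qed.

Lemma mpd_cst {m n : nat} (i : 'I_5) (M : 'M[R]_(m, n)) (p : V) :
  mpd i (fun=> M) p = 0.
Proof. by apply/matrixP => k l; rewrite !mxE /pd derive_cst. Qed.

Lemma pdC (f : V -> R) (i j : 'I_5) (p : V) :
  elementary f -> pd i (pd j f) p = pd j (pd i f) p.
Proof. exact: elementary_deriveC. Qed.

Lemma mpdC {m n : nat} {M : V -> 'M[R]_(m, n)} (i j : 'I_5) (p : V) :
  mx_elementary M -> mpd i (mpd j M) p = mpd j (mpd i M) p.
Proof.
move=> eM; apply/matrixP => a b; rewrite [LHS]mxE [RHS]mxE.
have E l : (fun x => mpd l M x a b) = pd l (fun x => M x a b).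
  by apply/funext => x; rewrite mxE.
by rewrite (E i) (E j); apply: pdC; exact: eM.
Qed.

End MatrixFields.

(** * Vanishing of the Weyl part of a Kulkarni-Nomizu product *)

Section WeylAlgebra.
Context {R : realType}.
Notation V := 'rV[R]_5.

(** [P] is the Schouten tensor. In dimension 5 the contractions of the assumed curvature are
    [Ric = 3 P + t G] and [Scal = 8 t], with [t] the trace of [P]; hence
    [P = Ric / 3 - Scal / 24 G], and the Weyl tensor subtracts exactly the Kulkarni-Nomizu product
    of [G] and [P]. *)
Lemma weyl_kulkarni_nomizu (g : V -> V -> V -> R) (p : V) (P : 'M[R]_5) :
  gmx g p \in unitmx -> (gmx g p)^T = gmx g p -> P^T = P ->
  (forall l k i j, riemann_up g l k i j p =
     (l == i)%:R * P j k - (l == j)%:R * P i k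
     + (invmx (gmx g p) *m P) l i * gmx g p j k
     - (invmx (gmx g p) *m P) l j * gmx g p i k) ->
  forall l k i j, weyl g l k i j p = 0.
Proof.
have [G EG] : exists G, gmx g p = G by exists (gmx g p).
rewrite EG => uG GT PT Rup l k i j.
set t := \tr (invmx G *m P).
have delta_sum (F : 'I_5 -> R) a : \sum_b (b == a)%:R * F b = F a.
  rewrite (bigD1 a) //= eqxx mul1r big1 ?addr0 // => b /negPf ->.
  by rewrite mul0r.
have Gsym a b : G a b = G b a by rewrite -[in LHS]GT mxE.
have Psym a b : P a b = P b a by rewrite -[in LHS]PT mxE.
have Ric a b : ricci g a b p = 3 * P a b + t * G a b.
  rewrite /ricci; under eq_bigr do rewrite Rup.
  rewrite !big_split /= !sumrN.
  have -> : \sum_(c < 5) (c == c)%:R * P b a = 5 * P a b.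
    under eq_bigr do rewrite eqxx mul1r.
    by rewrite sumr_const card_ord Psym mulr_natl.
  rewrite delta_sum -mulr_suml.
  have -> : \sum_(c < 5) (invmx G *m P) c b * G c a = P a b.
    transitivity ((G *m (invmx G *m P)) a b).
      by rewrite [RHS]mxE; apply: eq_bigr => c _; rewrite mulrC Gsym.
    by rewrite mulKVmx.
  rewrite -/(\tr _) -/t (Psym b a) (Gsym b a); ring.
have trG : \sum_a \sum_b invmx G a b * G a b = 5.
  transitivity (\tr (invmx G *m G)).
    apply: eq_bigr => a _; rewrite mxE; apply: eq_bigr => b _.
    by rewrite (Gsym a b).
  by rewrite mulVmx // mxtrace1.
have trP : \sum_a \sum_b invmx G a b * P a b = t.
  apply: eq_bigr => a _; rewrite mxE; apply: eq_bigr => b _.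
  by rewrite (Psym a b).
have Sc : scalar_curv g p = 8 * t.
  rewrite /scalar_curv EG.
  transitivity (3 * t + t * 5); last by ring.
  rewrite -[in t * 5]trG -{1}trP !mulr_sumr -big_split /=.
  apply: eq_bigr => a _; rewrite !mulr_sumr -big_split /=.
  by apply: eq_bigr => b _; rewrite Ric; ring.
have Rie : riemann g l k i j p =
    G l i * P j k - G l j * P i k + P l i * G j k - P l j * G i k.
  rewrite /riemann EG; under eq_bigr do rewrite Rup !mulrDr !mulrN.
  rewrite !big_split /= !sumrN.
  have sum1 a c : \sum_b G l b * ((b == a)%:R * c) = G l a * c.
    under eq_bigr do rewrite mulrCA; exact: (delta_sum (fun b => G l b * c)).
  have sum2 a c : \sum_b G l b * ((invmx G *m P) b a * c) = P l a * c.
    under eq_bigr do rewrite mulrA.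
    rewrite -mulr_suml; congr (_ * _).
    by rewrite -[in RHS](mulKVmx uG P) [RHS]mxE.
  by rewrite !sum1 !sum2.
rewrite /weyl EG Rie Sc !Ric (Psym k j) (Psym k i) (Gsym k j) (Gsym k i); by field.
Qed.

End WeylAlgebra.

(** * Curvature under a conformal change of a flat metric *)

(** Product rule for [b%:M + v *m s - z *m y] with [b], [v], [s] constant, completed by the
    commutator with [M]. The terms in [a] cancel because [z] and [y] scale inversely, and the
    products of [M] with [z *m y] cancel against the commutator. *)
Lemma conformal_derivative_aux {R : realType} (a b : R) (M : 'M[R]_5)
    (X v z dz : 'cV[R]_5) (y s Y dy : 'rV[R]_5) :
  dz = - (a *: z + X + M *m z) -> dy = a *: y + Y + y *m M ->
  - (dz *m y + z *m dy) + M *m (b%:M + v *m s - z *m y)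
    - (b%:M + v *m s - z *m y) *m M
  = X *m y - z *m Y + (M *m v) *m s - v *m (s *m M).
Proof.
move=> -> ->; rewrite !(mulmxDl, mulmxDr, mulNmx, mulmxN, mulmxA).
rewrite -!scalemxAl -!scalemxAr -scalar_mxC.
move: (X *m y) (M *m z *m y) (z *m Y) (z *m y *m M) (M *m v *m s) (v *m s *m M).
move: (b%:M *m M) (z *m y) => ? ? ? ? ? ? ? ?.
by apply/matrixP => k l; rewrite !mxE; ring.
Qed.

(** Products of rank one matrices contract to scalars. The terms in [z *m s] cancel since [y *m v']
    and [y' *m v] are the same scalar [c], which will be a coefficient of the symmetric metric. *)
Lemma conformal_commutator_aux {R : realType} (b b' c n : R) (v v' z : 'cV[R]_5)
    (s y y' : 'rV[R]_5) :
  s *m v = b%:M -> s *m v' = b'%:M -> s *m z = n%:M ->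
  y *m v' = c%:M -> y' *m v = c%:M -> y *m z = b%:M -> y' *m z = b'%:M ->
  (b%:M + v *m s - z *m y) *m (b'%:M + v' *m s - z *m y')
    - (b'%:M + v' *m s - z *m y') *m (b%:M + v *m s - z *m y)
  = b' *: (v *m s) - b *: (v' *m s) - n *: (v *m y' - v' *m y)
    + b *: (z *m y') - b' *: (z *m y).
Proof.
have prod a (A C : 'cV[R]_5) (B D : 'rV[R]_5) :
    B *m C = a%:M -> A *m B *m (C *m D) = a *: (A *m D).
  by move=> E; rewrite mulmxA -(mulmxA A) E mul_mx_scalar -scalemxAl.
move=> sv sv' sz yv' y'v yz y'z.
rewrite !(mulmxDl, mulmxDr, mulNmx, mulmxN) !mul_scalar_mx !mul_mx_scalar.
rewrite (prod _ _ _ _ _ sv) (prod _ _ _ _ _ sv') !(prod _ _ _ _ _ sz).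
rewrite (prod _ _ _ _ _ yv') (prod _ _ _ _ _ y'v) (prod _ _ _ _ _ yz).
rewrite (prod _ _ _ _ _ y'z).
move: (v *m s) (v' *m s) (v *m y') (v' *m y) (z *m y) (z *m y') (z *m s).
by move=> ? ? ? ? ? ? ?; apply/matrixP => k l; rewrite !mxE; ring.
Qed.

Section ConformalChange.
Context {R : realType}.
Notation V := 'rV[R]_5.
Variables (g : V -> V -> V -> R) (f : 'rV[R]_5).
Variables (G H : V -> 'M[R]_5) (L : 'I_5 -> V -> 'M[R]_5).

Hypothesis gG : forall p, gmx g p = G p.
Hypothesis eG : mx_elementary G.
Hypothesis eH : mx_elementary H.
Hypothesis eL : forall i, mx_elementary (L i).
Hypothesis GH : forall p, G p *m H p = 1%:M.
Hypothesis GT : forall p, (G p)^T = G p.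
(** The three conditions on [L]: it is torsion free, it makes [exp (- 2 sum_i f_i x_i) G] parallel,
    and it has zero curvature. So [L] is the Levi-Civita connection of a flat metric conformal to
    [g]. *)
Hypothesis L_sym : forall i j p l, L i p l j = L j p l i.
Hypothesis mpdG : forall i p,
  mpd i G p = (2 * f ord0 i) *: G p + (L i p)^T *m G p + G p *m L i p.
Hypothesis L_flat : forall i j p,
  mpd i (L j) p - mpd j (L i) p + (L i p *m L j p - L j p *m L i p) = 0.

Let HG p : H p *m G p = 1%:M. Proof. exact: mulmx1C. Qed.

Let uG p : G p \in unitmx. Proof. by have [] := mulmx1_unit (GH p). Qed.

Let HE p : H p = invmx (G p).
Proof. by rewrite -[RHS]mulmx1 -(GH p) mulKmx. Qed.

Let e (i : 'I_5) : 'cV[R]_5 := delta_mx i ord0.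
Let h p : 'cV[R]_5 := H p *m f^T.
(* the change of the connection matrices when the flat metric is multiplied by
   exp (2 sum_i f_i x_i); the weights f_i being constant, their Hessian is 0 *)
Let T i p : 'M[R]_5 := (f ord0 i)%:M + e i *m f - h p *m row i (G p).
Let K i p : 'M[R]_5 := L i p + T i p.

Let eh : mx_elementary h.
Proof. by apply: mx_elementaryM => //; exact: mx_elementary_cst. Qed.

Let rowE n (M : 'M[R]_(5, n)) i : row i M = (e i)^T *m M.
Proof. by rewrite /e trmx_delta -rowE. Qed.

(** [K] is the Levi-Civita connection of [g]: [S] is [K i p] with its upper index lowered by [G p].
    In the Christoffel formula the symmetry of [L] cancels four of the six terms containing [L] and
    identifies the other two. *)
Let christoffelE l i k p : christoffel g l i k p = K i p l k.
Proof.
pose S : 'M[R]_5 := f ord0 i *: G p + (G p *m e i) *m f - f^T *m row i (G p)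
  + G p *m L i p.
have -> : K i p = H p *m S.
  rewrite /S mulmxDr mulmxBr mulmxDr -scalemxAr HG scalemx1.
  by rewrite !mulmxA HG !mul1mx -/(h p) /K addrC.
have dG a b c : pd a (fun x => gmx g x b c) p = 2 * f ord0 a * G p b c
    + (G p *m L a p) c b + (G p *m L a p) b c.
  transitivity (mpd a G p b c).
    by rewrite [RHS]mxE; congr (pd _ _ _); apply/funext => x; rewrite gG.
  rewrite mpdG mxE [in LHS]mxE [in LHS]mxE -{2}(GT p) -trmx_mul.
  by rewrite [(_ ^T) b c]mxE.
have GLs a b c : (G p *m L a p) b c = (G p *m L c p) b a.
  by rewrite [LHS]mxE [RHS]mxE; apply: eq_bigr => m _; rewrite L_sym.
have Gs a b : G p a b = G p b a by rewrite -[in LHS]GT mxE.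
rewrite /christoffel gG -HE [RHS]mxE mulr_sumr; apply: eq_bigr => m _.
rewrite !dG (GLs i k m) (GLs k m i) (GLs k i m).
have -> : S m k = f ord0 i * G p m k + G p m i * f ord0 k
    - f ord0 m * G p i k + (G p *m L i p) m k.
  by rewrite /S /e -colE !mxE !big_ord1 !mxE.
rewrite (Gs k m) (Gs i m).
by field.
Qed.



(** For [F = sum_i f_i x_i], the rows [w i] form minus the Hessian of [F] with respect to [L], and
    [nu] is the squared norm of [dF] in the metric [G]. *)
Let w i p : 'rV[R]_5 := f *m L i p.
Let nu p : R := (f *m h p) ord0 ord0.

Let mpdH i p : mpd i H p = - (H p *m mpd i G p *m H p).
Proof.
have : mpd i (fun x => G x *m H x) p = 0.
  by under eq_fun do rewrite GH; exact: mpd_cst.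
rewrite mpdM // => /eqP; rewrite addrC addr_eq0 => /eqP E.
by rewrite -[LHS]mul1mx -(HG p) -mulmxA E mulmxN mulmxA.
Qed.

Let mpdh i p :
  mpd i h p = - ((2 * f ord0 i) *: h p + H p *m (w i p)^T + L i p *m h p).
Proof.
rewrite mpdM //; last exact: mx_elementary_cst.
rewrite mpd_cst mulmx0 addr0 mpdH mpdG mulNmx; congr (- _).
rewrite !mulmxDr !mulmxDl -scalemxAr -!scalemxAl HG mul1mx.
by rewrite /h /w trmx_mul !mulmxA HG mul1mx -[H p *m _ *m G p *m H p]mulmxA GH mulmx1.
Qed.

Let mpdg i j p : mpd i (fun x => row j (G x)) p =
  (2 * f ord0 i) *: row j (G p) + (L i p *m e j)^T *m G p
  + row j (G p) *m L i p.
Proof.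
rewrite mpd_row mpdG !rowE !mulmxDr -scalemxAr.
by rewrite trmx_mul !mulmxA.
Qed.

Let eT i : mx_elementary (T i).
Proof.
move=> a b.
have E : (fun p => T i p a b) = fun p =>
    ((f ord0 i)%:M + e i *m f) a b + - (h p *m row i (G p)) a b.
  by apply/funext => p; rewrite /T [LHS]mxE; congr (_ + _); rewrite mxE.
rewrite E; apply: elementaryD; first exact: elementary_cst.
apply: elementaryN; apply: mx_elementaryM => //; exact: mx_elementary_row.
Qed.

Let covT i j p :
  mpd i (T j) p + L i p *m T j p - T j p *m L i p
  = (H p *m (w i p)^T) *m row j (G p) - h p *m ((L i p *m e j)^T *m G p)
    + (L i p *m e j) *m f - e j *m w i p.
Proof.
rewrite -(conformal_derivative_aux _ (f ord0 j) _ _ _ _ _ _ _ _ _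
  (mpdh i p) (mpdg i j p)).
congr (_ + _ - _).
have egh : mx_elementary (fun x => h x *m row j (G x)).
  by apply: mx_elementaryM => //; exact: mx_elementary_row.
rewrite (mpdD i (fun=> _) (fun x => - (h x *m row j (G x)))); last 2 first.
- exact: mx_elementary_cst.
- by move=> a b; under eq_fun do rewrite mxE; apply: elementaryN; exact: egh.
by rewrite mpd_cst add0r mpdN // mpdM //; exact: mx_elementary_row.
Qed.

Let commT i j p :
  T i p *m T j p - T j p *m T i p
  = f ord0 j *: (e i *m f) - f ord0 i *: (e j *m f)
    - nu p *: (e i *m row j (G p) - e j *m row i (G p))
    + f ord0 i *: (h p *m row j (G p)) - f ord0 j *: (h p *m row i (G p)).
Proof.
have M11 (M : 'M[R]_1) : M = (M ord0 ord0)%:M by rewrite -mx11_scalar.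
have fe k : f *m e k = (f ord0 k)%:M by rewrite -colE [LHS]M11 mxE.
have ge k l : row k (G p) *m e l = (G p k l)%:M by rewrite -colE [LHS]M11 !mxE.
have gh k : row k (G p) *m h p = (f ord0 k)%:M.
  by rewrite rowE -mulmxA /h (mulmxA (G p)) GH mul1mx -trmx_mul fe tr_scalar_mx.
(* The common contraction of the commutator identity is the metric coefficient [G p i j]. *)
apply: (conformal_commutator_aux _ _ (G p i j)) => //.
by rewrite ge -[in LHS]GT mxE.
Qed.

(** The curvature of [L + T] is that of [L], plus the antisymmetrised [L]-covariant derivative of
    [T], plus the commutator of [T] with itself. The first vanishes by [L_flat]. *)
Let curvE l k i j p : riemann_up g l k i j p =
  ((mpd i (T j) p + L i p *m T j p - T j p *m L i p)
   - (mpd j (T i) p + L j p *m T i p - T i p *m L j p)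
   + (T i p *m T j p - T j p *m T i p)) l k.
Proof.
have dC a b c d y :
    pd a (christoffel g b c d) y = mpd a (L c) y b d + mpd a (T c) y b d.
  transitivity (mpd a (fun x => L c x + T c x) y b d).
    rewrite [RHS]mxE; congr (pd _ _ _); apply/funext => x.
    exact: christoffelE.
  by rewrite mpdD // mxE.
transitivity ((mpd i (L j) p + mpd i (T j) p - (mpd j (L i) p + mpd j (T i) p)
    + (K i p *m K j p - K j p *m K i p)) l k).
  have addE (X Y : 'M[R]_5) : (X + Y) l k = X l k + Y l k by rewrite mxE.
  have oppE (X : 'M[R]_5) : (- X) l k = - X l k by rewrite mxE.
  rewrite /riemann_up !dC !(addE, oppE); congr (_ + _).
  rewrite [X in _ = X + _]mxE [X in _ = _ - X]mxE -sumrB.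
  by apply: eq_bigr => m _; rewrite !christoffelE.
have -> : K i p *m K j p - K j p *m K i p = (L i p *m L j p - L j p *m L i p)
    + (L i p *m T j p - T j p *m L i p - (L j p *m T i p - T i p *m L j p)
       + (T i p *m T j p - T j p *m T i p)).
  rewrite /K !(mulmxDl, mulmxDr).
  move: (L i p *m L j p) (L j p *m L i p) (L i p *m T j p) (T j p *m L i p).
  move: (L j p *m T i p) (T i p *m L j p) (T i p *m T j p) (T j p *m T i p).
  by move=> ? ? ? ? ? ? ? ?; apply/matrixP => a b; rewrite !mxE; ring.
have := L_flat i j p.
move: (L i p *m L j p - L j p *m L i p) (L i p *m T j p) (T j p *m L i p).
move: (L j p *m T i p) (T i p *m L j p) (T i p *m T j p - T j p *m T i p).
move: (mpd i (L j) p) (mpd j (L i) p) (mpd i (T j) p) (mpd j (T i) p).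
move=> ? ? ? ? ? ? ? ? ? ? /matrixP/(_ l k) E.
move: E; rewrite !mxE => E.
by apply/eqP; rewrite -subr_eq0 -[X in _ == X]E; apply/eqP; ring.
Qed.

Lemma conformal_change_weyl_flat : weyl_flat g.
Proof.
move=> p; split; first by rewrite gG.
(* The classical transformed Schouten tensor [- Hess F + dF dF - |dF|^2 G / 2], starting from a flat
   metric whose own Schouten tensor is 0. *)
pose P : 'M[R]_5 := \matrix_(i, k) w i p ord0 k + f^T *m f - (nu p / 2) *: G p.
have wS i k : w i p ord0 k = w k p ord0 i.
  by rewrite [LHS]mxE [RHS]mxE; apply: eq_bigr => m _; rewrite L_sym.
have Gs a b : G p a b = G p b a by rewrite -[in LHS]GT mxE.
have PE a b : P a b = w a p ord0 b + f ord0 a * f ord0 b - nu p / 2 * G p a b.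
  by rewrite !mxE big_ord1 !mxE.
apply: (weyl_kulkarni_nomizu _ _ P); rewrite ?gG //.
  apply/matrixP => a b; rewrite mxE !PE wS (Gs a b); ring.
move=> l k i j; rewrite curvE !covT commT -HE.
have HP a b : (H p *m P) a b = (H p *m (w b p)^T) a ord0 + h p a ord0 * f ord0 b
    - nu p / 2 * (a == b)%:R.
  rewrite /P mulmxBr mulmxDr -scalemxAr HG mulmxA -/(h p).
  rewrite [LHS]mxE; congr (_ + _); last by rewrite !mxE.
  rewrite [LHS]mxE; congr (_ + _); last by rewrite mxE big_ord1.
  rewrite [LHS]mxE [RHS]mxE; apply: eq_bigr => m _; congr (_ * _).
  by rewrite [LHS]mxE [RHS]mxE; exact: wS.
(* By torsion freeness the terms of [covT] in [L i p *m e j] are symmetric in [i] and [j], so they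
   drop out of the curvature. *)
have Le : L i p *m e j = L j p *m e i.
  by rewrite -!colE; apply/matrixP => a b; rewrite !mxE L_sym.
rewrite Le !HP !PE.
have gE a b c (X : 'cV[R]_5) : (X *m row a (G p)) b c = X b ord0 * G p a c.
  by rewrite mxE big_ord1 mxE.
have eE a b c (X : 'rV[R]_5) : (e a *m X) b c = (b == a)%:R * X ord0 c.
  by rewrite mxE big_ord1 mxE eqxx andbT.
have hE b c (X : 'rV[R]_5) : (h p *m X) b c = h p b ord0 * X ord0 c.
  by rewrite mxE big_ord1.
move: (L j p *m e i) (H p *m (w i p)^T) (H p *m (w j p)^T) => S X Y.
have addE (A B : 'M[R]_5) : (A + B) l k = A l k + B l k by rewrite mxE.
have oppE (A : 'M[R]_5) : (- A) l k = - A l k by rewrite mxE.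
have sclE a (A : 'M[R]_5) : (a *: A) l k = a * A l k by rewrite mxE.
have eiE a : e a l ord0 = (l == a)%:R by rewrite mxE andbT.
rewrite !(addE, oppE, sclE, gE, eE, hE) !eiE.
by field.
Qed.

End ConformalChange.

(** * Metrics conformal to the pull-back of a constant metric *)

Section ConformallyFlat.
Context {R : realType}.
Notation V := 'rV[R]_5.
(** [J] is the constant metric in the target coordinates [r], and [u] is a conformal factor whose
    logarithm has the constant differential [2 f]. The inverse metric is a variable [H], so that it
    can be required to be elementary and hence differentiated. *)
Variables (g : V -> V -> V -> R) (r : 'I_5 -> V -> R) (J : 'M[R]_5).
Variables (u : V -> R) (f : 'rV[R]_5) (H : V -> 'M[R]_5).

Let A (p : V) : 'M[R]_5 := \matrix_(a, i) pd i (r a) p.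
Let G (p : V) : 'M[R]_5 := u p *: ((A p)^T *m J *m A p).

Hypothesis er : forall a, elementary (r a).
Hypothesis eu : elementary u.
Hypothesis eH : mx_elementary H.
Hypothesis JT : J^T = J.
Hypothesis du : forall i p, pd i u p = 2 * f ord0 i * u p.
Hypothesis GH : forall p, G p *m H p = 1%:M.
Hypothesis gG : forall p, gmx g p = G p.

Let eA : mx_elementary A.
Proof. by move=> a i; under eq_fun do rewrite mxE; exact: elementary_derive. Qed.

Let eG : mx_elementary G.
Proof.
apply: mx_elementaryZ => //; apply: mx_elementaryM => //.
apply: mx_elementaryM; last exact: mx_elementary_cst.
exact: mx_elementaryT.
Qed.

Let HG p : H p *m G p = 1%:M. Proof. exact: mulmx1C. Qed.

Let GT p : (G p)^T = G p.
Proof. by rewrite linearZ /= !trmx_mul JT trmxK mulmxA. Qed.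

(* B is the inverse of the Jacobian A, and L i the connection matrix of the
   flat metric in the coordinates pulled back through r *)
Let B p : 'M[R]_5 := u p *: (H p *m (A p)^T *m J).
Let L i p : 'M[R]_5 := B p *m mpd i A p.

Let BA p : B p *m A p = 1%:M.
Proof. by rewrite /B -scalemxAl -(HG p) /G -scalemxAr !mulmxA. Qed.

Let eB : mx_elementary B.
Proof.
apply: mx_elementaryZ => //; apply: mx_elementaryM; last exact: mx_elementary_cst.
by apply: mx_elementaryM => //; exact: mx_elementaryT.
Qed.

Let eL i : mx_elementary (L i).
Proof. by apply: mx_elementaryM => //; exact: mx_elementary_mpd. Qed.

Let mpdA_sym i j p a : mpd i A p a j = mpd j A p a i.
Proof.
have E k : (fun x => A x a k) = pd k (r a) by apply/funext => x; rewrite [LHS]mxE.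
rewrite [LHS]mxE [RHS]mxE (E i) (E j).
exact: pdC.
Qed.

Let L_sym i j p l : L i p l j = L j p l i.
Proof.
rewrite /L [LHS]mxE [RHS]mxE; apply: eq_bigr => a _.
by congr (_ * _); exact: mpdA_sym.
Qed.

Let mpdG i p :
  mpd i G p = (2 * f ord0 i) *: G p + (L i p)^T *m G p + G p *m L i p.
Proof.
have AL : A p *m L i p = mpd i A p by rewrite /L mulmxA (mulmx1C (BA p)) mul1mx.
rewrite {1}/G mpdZ //; last first.
  apply: mx_elementaryM => //; apply: mx_elementaryM; last exact: mx_elementary_cst.
  exact: mx_elementaryT.
rewrite du -scalerA -/(G p) -addrA; congr (_ + _).
rewrite mpdM //; last first.
  by apply: mx_elementaryM (mx_elementary_cst _); exact: mx_elementaryT.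
rewrite mpdM //; [|exact: mx_elementaryT|exact: mx_elementary_cst].
rewrite mpd_cst mulmx0 addr0 mpdT scalerDr /G -scalemxAr -scalemxAl.
by rewrite -[in LHS]AL trmx_mul !mulmxA.
Qed.

Let mpdB i p : mpd i B p = - (L i p *m B p).
Proof.
have : mpd i (fun x => B x *m A x) p = 0.
  by under eq_fun do rewrite BA; exact: mpd_cst.
rewrite mpdM // => /eqP; rewrite addr_eq0 => /eqP E.
by rewrite -[LHS]mulmx1 -(mulmx1C (BA p)) mulmxA E mulNmx.
Qed.

(** [L] is the pure gauge connection [A^-1 dA]: the second derivatives of [A] cancel by symmetry,
    and what remains is the Maurer-Cartan identity. *)
Let L_flat i j p :
  mpd i (L j) p - mpd j (L i) p + (L i p *m L j p - L j p *m L i p) = 0.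
Proof.
have dL k l : mpd k (L l) p = - (L k p *m L l p) + B p *m mpd k (mpd l A) p.
  rewrite mpdM //; last exact: mx_elementary_mpd.
  by rewrite mpdB mulNmx -mulmxA.
have S := mpdC j i p eA.
rewrite (dL i j) (dL j i) S.
have aux (X Y Z : 'M[R]_5) : - X + Z - (- Y + Z) + (X - Y) = 0.
  by apply/matrixP => a b; rewrite !mxE; ring.
exact: aux.
Qed.

Lemma conformally_flat_weyl0 : weyl_flat g.
Proof. exact: (conformal_change_weyl_flat g f G H L). Qed.

End ConformallyFlat.

(** * Reification of concrete functions as elementary expressions *)

(** The order of the cases matters: an entry of the bound point is a variable, while the last case
    takes everything independent of the point, including the entries of other vectors, as a
    constant. *)
Ltac reify_elem f :=
  lazymatch f with
  | (fun p => @GRing.add _ (@?a p) (@?b p)) =>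
      let a := reify_elem a in let b := reify_elem b in constr:(Add a b)
  | (fun p => @GRing.mul _ (@?a p) (@?b p)) =>
      let a := reify_elem a in let b := reify_elem b in constr:(Mul a b)
  | (fun p => @GRing.opp _ (@?a p)) =>
      let a := reify_elem a in constr:(Opp a)
  | (fun p => expR (@?a p)) => let a := reify_elem a in constr:(Exp a)
  | (fun p => sin (@?a p)) => let a := reify_elem a in constr:(Sin a)
  | (fun p => cos (@?a p)) => let a := reify_elem a in constr:(Cos a)
  | (fun p => @fun_of_matrix ?K _ _ p _ ?i) => constr:(@Var K i)
  | (fun _ => ?c) => constr:(Cst c)
  end.

Ltac unfold_fields f :=
  eval cbv beta zeta delta [r1 r2 r3 r4 r5 theta phi x q psi] in f.

Ltac elementary_field :=
  match goal with |- elementary ?f =>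
    let g := unfold_fields f in
    let e := reify_elem g in exists e; reflexivity
  end.

Ltac derive_field :=
  match goal with |- context [derive ?f ?p ?v] =>
    let g := unfold_fields f in
    let e := reify_elem g in
    rewrite [derive f p v]((eval_diff e p).2 v) /=
  end.

(** * The adapted frame and the identity between [ds2] and [gtilde] *)

Section Frame.
Context {R : realType}.
Notation V := 'rV[R]_5.
Implicit Types p u v w : V.

Lemma dE (f : V -> R) p v : elementary f -> d f p v = 'D_v f p.
Proof. by move=> ef; rewrite deriveE //; exact: elementary_diff. Qed.

Lemma r1_elementary : elementary (@r1 R). Proof. elementary_field. Qed.
Lemma r2_elementary : elementary (@r2 R). Proof. elementary_field. Qed.
Lemma r3_elementary : elementary (@r3 R). Proof. elementary_field. Qed.
Lemma r4_elementary : elementary (@r4 R). Proof. elementary_field. Qed.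
Lemma r5_elementary : elementary (@r5 R). Proof. elementary_field. Qed.

Lemma d_coord (i : 'I_5) p v : d (fun w => w ord0 i) p v = v ord0 i.
Proof.
rewrite dE; last by exists (Var i).
exact: (eval_diff (Var i) p).2.
Qed.

Lemma d_theta p v : d (@theta R) p v = theta v. Proof. exact: d_coord. Qed.
Lemma d_phi p v : d (@phi R) p v = phi v. Proof. exact: d_coord. Qed.
Lemma d_x p v : d (@x R) p v = x v. Proof. exact: d_coord. Qed.
Lemma d_q p v : d (@q R) p v = q v. Proof. exact: d_coord. Qed.
Lemma d_psi p v : d (@psi R) p v = psi v. Proof. exact: d_coord. Qed.

Definition fa p v := theta v.
Definition fb p v := expR (theta p) * phi v.
Definition fc p v := cos (psi p) * x v + sin (psi p) * expR (3 * x p) * q v.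
Definition fs p v := - sin (psi p) * x v + cos (psi p) * expR (3 * x p) * q v.
Definition fw p v := psi v - expR (theta p) * phi v + 3 * expR (3 * x p) * q v.

Lemma omega1E p v : omega1 p v = fa p v - fc p v.
Proof. by rewrite /omega1 d_theta d_x d_q /fa /fc; ring. Qed.

Lemma omega2E p v : omega2 p v = fb p v - fs p v.
Proof. by rewrite /omega2 d_phi d_x d_q /fb /fs; ring. Qed.

Lemma omega3E p v : omega3 p v = fw p v.
Proof. by rewrite /omega3 /psi /phi /q !d_coord /fw /phi /psi /q; ring. Qed.

(** Rotation by [psi] preserves [dx^2 + e^(6x) dq^2], which thus becomes [fc^2 + fs^2]; all
    coefficients of [gtilde] in the frame are then constant. *)
Lemma gtildeE p u v : gtilde p u v =
  fa p u * fa p v + fb p u * fb p v - fc p u * fc p v - fs p u * fs p v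
  - 1 / 2 * ((fa p u - fc p u) * (fa p v - fc p v)
             + (fb p u - fs p u) * (fb p v - fs p v))
  + 1 / 6 * (fw p u * fw p v).
Proof.
have E2 : expR (2 * theta p) = expR (theta p) ^+ 2 by rewrite -expRM_natl.
have E6 : expR (6 * x p) = expR (3 * x p) ^+ 2.
  by rewrite -expRM_natl mulrA -natrM.
have cs := cos2sin2 (psi p).
rewrite /gtilde /symprod !omega1E !omega2E !omega3E.
rewrite !(d_theta, d_phi, d_x, d_q) E2 E6 /fa /fb /fc /fs.
move: (fw p u) (fw p v) (cos _) cs => ? ? ? cs.
by field: cs.
Qed.

(* In these variables the r_i and the frame are polynomial, so that the
   identities below hold modulo X X' = T T' = 1 and C^2 + S^2 = 1. *)
Let X p := expR (3 * x p / 2).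
Let X' p := expR (- (3 * x p / 2)).
Let T p := expR (- (theta p / 2)).
Let T' p := expR (theta p / 2).
Let S p := sin (psi p / 2).
Let C p := cos (psi p / 2).

Let XX' p : X p * X' p = 1. Proof. by rewrite /X /X' -expRD subrr expR0. Qed.
Let TT' p : T p * T' p = 1. Proof. by rewrite /T /T' -expRD addNr expR0. Qed.
Let C2 p : C p ^+ 2 = 1 - S p ^+ 2. Proof. exact: cos2sin2. Qed.

Let expR3xE p : expR (3 * x p) = X p ^+ 2.
Proof. by rewrite -expRM_natl; congr expR; field. Qed.

Let expRthetaE p : expR (theta p) = T' p ^+ 2.
Proof. by rewrite -expRM_natl; congr expR; field. Qed.

Let psi_halves p : psi p = (psi p / 2) *+ 2.
Proof. by rewrite -mulr_natl; field. Qed.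

Let sin_psiE p : sin (psi p) = 2 * S p * C p.
Proof.
by rewrite {1}psi_halves sin_mulr2n -mulr_natl -/(S p) -/(C p); ring.
Qed.

Let cos_psiE p : cos (psi p) = 2 * C p ^+ 2 - 1.
Proof. by rewrite {1}psi_halves cos_mulr2n -/(C p) -mulr_natl. Qed.

Let halves_r p :
  [/\ expR (3 * x p / 2 - theta p / 2) = X p * T p,
      expR (- (3 * x p / 2) - theta p / 2) = X' p * T p,
      expR (3 * x p / 2 - 3 * theta p / 2) = X p * T p ^+ 3,
      expR (- (3 * x p / 2) - 3 * theta p / 2) = X' p * T p ^+ 3 &
      expR (- (3 * theta p / 2)) = T p ^+ 3].
Proof.
rewrite !expRD -!/(X p) -!/(X' p) -!/(T p).
have -> : expR (- (3 * theta p / 2)) = T p ^+ 3.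
  by rewrite -expRM_natl; congr expR; field.
by [].
Qed.

Ltac derive_r h p v :=
  rewrite dE; last exact: h;
  derive_field;
  change (p ord0 (inord 0)) with (theta p);
  change (p ord0 (inord 1)) with (phi p);
  change (p ord0 (inord 2)) with (x p);
  change (p ord0 (inord 3)) with (q p);
  change (p ord0 (inord 4)) with (psi p);
  change (v ord0 (inord 0)) with (theta v);
  change (v ord0 (inord 1)) with (phi v);
  change (v ord0 (inord 2)) with (x v);
  change (v ord0 (inord 3)) with (q v);
  change (v ord0 (inord 4)) with (psi v);
  rewrite -?/(S p) -?/(C p) -?/(X p) -?/(T p) /fa /fb /fc /fs /fw;
  rewrite ?(expR3xE, expRthetaE, sin_psiE, cos_psiE).

Lemma d_r2 p v : d (@r2 R) p v = X p * T p / 2 *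
  (S p * fa p v + 3 * S p * fc p v + 3 * C p * fs p v
   - C p * (fw p v + fb p v)).
Proof.
derive_r r2_elementary p v.
have [-> _ _ _ _] := halves_r p.
have := C2 p; move: (C p) (S p) (X p) (T p) => c s X0 T0 cs.
by field: cs.
Qed.

(** Here and for [r4] and [r5], the parts carrying a bare [q] or [phi] are split off: [dr1] contains
    [q dr2], [dr5] contains [- phi/6 dr2], and [dr4] contains [phi/6 dr1 - q (dr5 + phi/6 dr2)]. In
    [2 dr1 dr5 + 2 dr2 dr4] all of them cancel. *)
Lemma d_r1 p v : d (@r1 R) p v = q p * d (@r2 R) p v + X' p * T p / 6 *
  (3 * S p * fs p v - 3 * C p * fc p v - C p * fa p v
   - S p * (fw p v + fb p v)).
Proof.
rewrite d_r2; derive_r r1_elementary p v.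
have [-> -> _ _ _] := halves_r p.
have := C2 p; have := XX' p.
move: (C p) (S p) (X p) (X' p) (T p) => c s X0 X1 T0 XX cs.
by field: cs XX.
Qed.

Lemma d_r3 p v : d (@r3 R) p v = - (1 / 3) * (T p ^+ 2 * fb p v).
Proof.
derive_r r3_elementary p v.
by have := TT' p; move: (T p) (T' p) => T0 T1 TT; field: TT.
Qed.

Lemma d_r5 p v : d (@r5 R) p v = X p * T p ^+ 3 / 12 *
    (3 * C p * fc p v - 3 * C p * fa p v - 3 * S p * fs p v
     - S p * (fw p v + fb p v))
  - phi p / 6 * d (@r2 R) p v + X p * T p * S p / 6 * (T p ^+ 2 * fb p v).
Proof.
rewrite d_r2; derive_r r5_elementary p v.
have [_ _ _ _ ->] := halves_r p.
have := C2 p; have := TT' p.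
move: (C p) (S p) (X p) (T p) (T' p) => c s X0 T0 T1 TT cs.
by field: cs TT.
Qed.

Lemma d_r4 p v : d (@r4 R) p v =
  (X' p * T p * C p / 3 - X p * T p * S p * q p) / 6 * (T p ^+ 2 * fb p v)
  + phi p / 6 * d (@r1 R) p v
  - q p * (X p * T p ^+ 3 / 12 *
    (3 * C p * fc p v - 3 * C p * fa p v - 3 * S p * fs p v
     - S p * (fw p v + fb p v)))
  - X' p * T p ^+ 3 / 36 * (3 * S p * fc p v + 3 * C p * fs p v
     - 3 * S p * fa p v + C p * (fw p v + fb p v)).
Proof.
rewrite d_r1 d_r2; derive_r r4_elementary p v.
have [-> -> -> -> _] := halves_r p.
have := C2 p; have := XX' p; have := TT' p.
move: (C p) (S p) (X p) (X' p) (T p) (T' p) => c s X0 X1 T0 T1 TT XX cs.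
by field: cs XX TT.
Qed.

Lemma ds2_gtilde p u v : ds2 p u v = 1 / 6 * expR (- 2 * theta p) * gtilde p u v.
Proof.
have -> : expR (- 2 * theta p) = T p ^+ 4.
  by rewrite -expRM_natl; congr expR; field.
rewrite gtildeE /ds2 /symprod !(d_r3, d_r5, d_r4, d_r1, d_r2).
have := C2 p; have := XX' p.
move: (C p) (S p) (X p) (X' p) (T p) => c s X0 X1 T0 XX cs.
move: (fa p u) (fb p u) (fc p u) (fs p u) (fw p u) => a b e f g.
move: (fa p v) (fb p v) (fc p v) (fs p v) (fw p v) => a' b' e' f' g'.
by field: cs XX.
Qed.

End Frame.

(** * The dual frame, the inverse of [gtilde] and its Weyl flatness *)

Section DualFrame.
Context {R : realType}.
Notation V := 'rV[R]_5.
Implicit Types p u v : V.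

Definition mkv (a b c d e : R) : V := \row_(i < 5) [:: a; b; c; d; e]`_i.

Lemma theta_mkv a b c d e : theta (mkv a b c d e) = a.
Proof. by rewrite /theta mxE inordK. Qed.
Lemma phi_mkv a b c d e : phi (mkv a b c d e) = b.
Proof. by rewrite /phi mxE inordK. Qed.
Lemma x_mkv a b c d e : x (mkv a b c d e) = c.
Proof. by rewrite /x mxE inordK. Qed.
Lemma q_mkv a b c d e : q (mkv a b c d e) = d.
Proof. by rewrite /q mxE inordK. Qed.
Lemma psi_mkv a b c d e : psi (mkv a b c d e) = e.
Proof. by rewrite /psi mxE inordK. Qed.

Definition mkvE := (theta_mkv, phi_mkv, x_mkv, q_mkv, psi_mkv).

Lemma mkv_coords v : mkv (theta v) (phi v) (x v) (q v) (psi v) = v.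
Proof.
apply/rowP => -[[|[|[|[|[|//]]]]] lti]; rewrite mxE /=;
  by congr (v _ _); apply/val_inj; rewrite /= inordK.
Qed.

Lemma mkv_linear k a b c d e a' b' c' d' e' :
  k *: mkv a b c d e + mkv a' b' c' d' e' =
  mkv (k * a + a') (k * b + b') (k * c + c') (k * d + d') (k * e + e').
Proof. by apply/rowP => -[[|[|[|[|[|//]]]]] lti]; rewrite !mxE. Qed.

Lemma mkv_elementary (a b c d e : V -> R) :
  elementary a -> elementary b -> elementary c -> elementary d ->
  elementary e ->
  mx_elementary (fun p => mkv (a p) (b p) (c p) (d p) (e p)).
Proof.
move=> ea eb ec ed ee i; rewrite (ord1 i) => -[[|[|[|[|[|//]]]]] lti];
  by under eq_fun do rewrite mxE /=.
Qed.

(* the vector with coordinates a, b, c, s, w in the frame dual to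
   (fa, fb, fc, fs, fw) *)
Definition vec p (a b c s w : R) : V :=
  mkv a (expR (- theta p) * b) (cos (psi p) * c - sin (psi p) * s)
    (expR (- (3 * x p)) * (sin (psi p) * c + cos (psi p) * s))
    (b + w - 3 * (sin (psi p) * c + cos (psi p) * s)).

Lemma fa_vec p a b c s w : fa p (vec p a b c s w) = a.
Proof. by rewrite /fa mkvE. Qed.

Lemma fb_vec p a b c s w : fb p (vec p a b c s w) = b.
Proof. by rewrite /fb mkvE mulrA -expRD subrr expR0 mul1r. Qed.

Lemma fc_vec p a b c s w : fc p (vec p a b c s w) = c.
Proof.
have E : expR (3 * x p) * expR (- (3 * x p)) = 1 by rewrite -expRD subrr expR0.
rewrite /fc !mkvE; have := cos2sin2 (psi p).
by move: E; move: (cos _) (sin _) (expR _) (expR _) => C S X X' E cs; ring: E cs.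
Qed.

Lemma fs_vec p a b c s w : fs p (vec p a b c s w) = s.
Proof.
have E : expR (3 * x p) * expR (- (3 * x p)) = 1 by rewrite -expRD subrr expR0.
rewrite /fs !mkvE; have := cos2sin2 (psi p).
by move: E; move: (cos _) (sin _) (expR _) (expR _) => C S X X' E cs; ring: E cs.
Qed.

Lemma fw_vec p a b c s w : fw p (vec p a b c s w) = w.
Proof.
have E : expR (3 * x p) * expR (- (3 * x p)) = 1 by rewrite -expRD subrr expR0.
have E' : expR (theta p) * expR (- theta p) = 1 by rewrite -expRD subrr expR0.
rewrite /fw !mkvE; move: E E'.
move: (cos _) (sin _) (expR _) (expR _) (expR _) (expR _) => C S X X' T T' E E'.
by ring: E E'.
Qed.

Definition vecE := (fa_vec, fb_vec, fc_vec, fs_vec, fw_vec).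

Lemma vec_frame p v : vec p (fa p v) (fb p v) (fc p v) (fs p v) (fw p v) = v.
Proof.
have E : expR (3 * x p) * expR (- (3 * x p)) = 1 by rewrite -expRD subrr expR0.
have E' : expR (theta p) * expR (- theta p) = 1 by rewrite -expRD subrr expR0.
rewrite -[RHS]mkv_coords; have := cos2sin2 (psi p); rewrite /vec /fa /fb /fc /fs /fw.
move: E E'.
move: (cos _) (sin _) (expR _) (expR _) (expR _) (expR _) => C S X X' T T' E E' cs.
by congr (mkv _ _ _ _ _); ring: E E' cs.
Qed.

Lemma vec_linear k p a b c s w a' b' c' s' w' :
  k *: vec p a b c s w + vec p a' b' c' s' w' =
  vec p (k * a + a') (k * b + b') (k * c + c') (k * s + s') (k * w + w').
Proof. by rewrite /vec mkv_linear; congr (mkv _ _ _ _ _); ring. Qed.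

Lemma vec0 p : vec p 0 0 0 0 0 = 0.
Proof.
have := vec_linear (-1) p 0 0 0 0 0 0 0 0 0 0.
by rewrite !mulr0 addr0 scaleN1r addNr.
Qed.

Lemma vec_scale k p a b c s w :
  k *: vec p a b c s w = vec p (k * a) (k * b) (k * c) (k * s) (k * w).
Proof. by rewrite -[LHS]addr0 -(vec0 p) vec_linear !addr0. Qed.

Lemma vec_add p a b c s w a' b' c' s' w' :
  vec p a b c s w + vec p a' b' c' s' w' =
  vec p (a + a') (b + b') (c + c') (s + s') (w + w').
Proof. by rewrite -[X in X + _]scale1r vec_linear !mul1r. Qed.

Lemma vec_elementary (a b c s w : V -> R) :
  elementary a -> elementary b -> elementary c -> elementary s ->
  elementary w ->
  mx_elementary (fun p => vec p (a p) (b p) (c p) (s p) (w p)).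
Proof.
move=> ea eb ec es ew.
have eC : elementary (fun p => cos (psi p)) by elementary_field.
have eS : elementary (fun p => sin (psi p)) by elementary_field.
have eT : elementary (fun p => expR (- theta p)) by elementary_field.
have eX : elementary (fun p => expR (- (3 * x p))) by elementary_field.
have eSC := elementaryD (elementaryM eS ec) (elementaryM eC es).
apply: mkv_elementary => //.
- exact: elementaryM.
- exact: elementaryD (elementaryM eC ec) (elementaryN (elementaryM eS es)).
- exact: elementaryM.
- exact: elementaryD (elementaryD eb ew) (elementaryN (elementaryZ eSC)).
Qed.

Lemma linear_sum_delta (h : V -> R) v :
  (forall k u w, h (k *: u + w) = k * h u + h w) ->
  h v = \sum_i v ord0 i * h (delta_mx ord0 i).
Proof.
move=> hl; pose L := GRing.isLinear.Build R V R _ h hl.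
pose F : {linear V -> R} := HB.pack h L.
have -> : h v = F (\sum_i v ord0 i *: delta_mx ord0 i) by rewrite -row_sum_delta.
by rewrite linear_sum; apply: eq_bigr => i _; exact: (linearZ_LR F).
Qed.

Lemma frame_linear p k u v :
  [/\ fa p (k *: u + v) = k * fa p u + fa p v,
      fb p (k *: u + v) = k * fb p u + fb p v,
      fc p (k *: u + v) = k * fc p u + fc p v,
      fs p (k *: u + v) = k * fs p u + fs p v &
      fw p (k *: u + v) = k * fw p u + fw p v].
Proof.
rewrite -(vec_frame p u) -(vec_frame p v) vec_linear.
by rewrite !fa_vec !fb_vec !fc_vec !fs_vec !fw_vec.
Qed.

(** The metric duals of the frame: [gtilde p u (Ya p) = fa p u], and so on. On [(fa, fc)], and
    likewise on [(fb, fs)], [gtilde] has rows [(1/2, 1/2)] and [(1/2, -3/2)], of determinant -1, and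
    the inverse block gives the coefficients; [fw] has weight 1/6. Lowering the first factors of [H]
    therefore leaves the resolution of the identity by the frame and its dual. *)
Let Ya p : V := vec p (3 / 2) 0 (1 / 2) 0 0.
Let Yb p : V := vec p 0 (3 / 2) 0 (1 / 2) 0.
Let Yc p : V := vec p (1 / 2) 0 (- 1 / 2) 0 0.
Let Ys p : V := vec p 0 (1 / 2) 0 (- 1 / 2) 0.
Let Yw p : V := vec p 0 0 0 0 6.

Let H p : 'M[R]_5 :=
  (Ya p)^T *m vec p 1 0 0 0 0 + (Yb p)^T *m vec p 0 1 0 0 0
  + (Yc p)^T *m vec p 0 0 1 0 0 + (Ys p)^T *m vec p 0 0 0 1 0
  + (Yw p)^T *m vec p 0 0 0 0 1.

Let eH : mx_elementary H.
Proof.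
have ev a b c s w : mx_elementary (fun p => vec p a b c s w).
  by apply: vec_elementary; exact: elementary_cst.
have em a b c s w a' b' c' s' w' : mx_elementary
    (fun p => (vec p a b c s w)^T *m vec p a' b' c' s' w').
  by apply: mx_elementaryM => //; exact: mx_elementaryT.
do 4![apply: mx_elementaryD; last exact: em].
exact: em.
Qed.

Lemma gmx_gtilde_mul p v i : (gmx (@gtilde R) p *m v^T) i ord0 =
  gtilde p (delta_mx ord0 i) v.
Proof.
rewrite mxE [RHS](linear_sum_delta (gtilde p (delta_mx ord0 i))) => [|k u w].
  by apply: eq_bigr => j _; rewrite !mxE mulrC.
have [Ea Eb Ec Es Ew] := frame_linear p k u w.
by rewrite !gtildeE Ea Eb Ec Es Ew; field.
Qed.

Lemma gmx_gtildeK p : gmx (@gtilde R) p *m H p = 1%:M.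
Proof.
have gY i a b c s w : (gmx (@gtilde R) p *m (vec p a b c s w)^T) i ord0 =
    gtilde p (delta_mx ord0 i) (vec p a b c s w) by exact: gmx_gtilde_mul.
apply/matrixP => i k; rewrite /H !mulmxDr !mulmxA.
have mulE (c : 'cV[R]_5) (r : V) : (c *m r) i k = c i ord0 * r ord0 k.
  by rewrite mxE big_ord1.
have addE (A B : 'M[R]_5) : (A + B) i k = A i k + B i k by rewrite mxE.
rewrite !addE !mulE !gY !gtildeE !vecE.
set u := delta_mx ord0 i : V.
transitivity (u ord0 k); last by rewrite !mxE eqxx eq_sym.
rewrite -[in RHS](vec_frame p u).
transitivity ((fa p u *: vec p 1 0 0 0 0 + (fb p u *: vec p 0 1 0 0 0
  + (fc p u *: vec p 0 0 1 0 0 + (fs p u *: vec p 0 0 0 1 0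
  + fw p u *: vec p 0 0 0 0 1)))) ord0 k); last first.
  rewrite [X in _ + (_ + (_ + (_ + X)))]vec_scale !vec_linear.
  by congr (vec _ _ _ _ _ _ _ _); ring.
by rewrite !mxE; field.
Qed.

Lemma gtilde_weyl_flat : weyl_flat (@gtilde R).
Proof.
pose r (a : 'I_5) : V -> R := [:: @r1 R; @r2 R; @r3 R; @r4 R; @r5 R]`_a.
(* With indices from 0, Engel's metric is the antidiagonal unit matrix. The covector [f] is
   [d theta], half the differential of the logarithm of [6 exp (2 theta)]. *)
pose J : 'M[R]_5 := \matrix_(a, b) (a + b == 4)%N%:R.
pose f : V := delta_mx ord0 (inord 0).
have er a : elementary (r a).
  case: a => -[|[|[|[|[|//]]]]] lta.
  - exact: r1_elementary.
  - exact: r2_elementary.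
  - exact: r3_elementary.
  - exact: r4_elementary.
  - exact: r5_elementary.
pose A p : 'M[R]_5 := \matrix_(a, i) pd i (r a) p.
have gG p : gmx (@gtilde R) p = (6 * expR (2 * theta p)) *: ((A p)^T *m J *m A p).
  apply/matrixP => i j; pose e k : V := delta_mx ord0 k.
  have AE a k : A p a k = d (r a) p (e k) by rewrite mxE dE.
  have -> : gmx (@gtilde R) p i j = 6 * expR (2 * theta p) * ds2 p (e i) (e j).
    rewrite ds2_gtilde [LHS]mxE -!/(e _).
    have E : expR (2 * theta p) * expR (- 2 * theta p) = 1.
      by rewrite -expRD mulNr subrr expR0.
    by move: E; move: (expR _) (expR _) => T T' E; field: E.
  rewrite [RHS]mxE; congr (_ * _).
  rewrite -mulmxA mxE; under eq_bigr => b _.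
    rewrite [X in X * _]mxE AE mxE.
    under eq_bigr => a _ do rewrite [X in X * _]mxE AE.
    over.
  rewrite !big_ord_recl !big_ord0 /r /= /ds2 /symprod.
  move: (d (@r1 R) p (e i)) (d (@r2 R) p (e i)) (d (@r3 R) p (e i)) (d (@r4 R) p (e i))
    (d (@r5 R) p (e i)).
  move: (d (@r1 R) p (e j)) (d (@r2 R) p (e j)) (d (@r3 R) p (e j)) (d (@r4 R) p (e j))
    (d (@r5 R) p (e j)).
  move=> ? ? ? ? ? ? ? ? ? ?.
  by field.
have eu : elementary (fun p : V => 6 * expR (2 * theta p)) by elementary_field.
apply: (conformally_flat_weyl0 _ r J _ f H er eu eH) => //.
- by apply/matrixP => a b; rewrite !mxE addnC.
- move=> i p; rewrite /pd; derive_field.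
  rewrite -/(theta p) !mxE eqxx /= eq_sym.
  by ring.
- by move=> p; rewrite -[X in X *m _]gG gmx_gtildeK.
Qed.

Lemma gtilde_nondegenerate p v : (forall u, gtilde p u v = 0) -> v = 0.
Proof.
move=> gv0; apply: trmx_inj; rewrite trmx0.
have [uG _] := gtilde_weyl_flat p.
rewrite -[LHS](mulKmx uG); suff -> : gmx (@gtilde R) p *m v^T = 0 by rewrite mulmx0.
by apply/matrixP => i j; rewrite (ord1 j) gmx_gtilde_mul gv0 mxE.
Qed.

End DualFrame.

(** * Structure equations, Cartan's adapted coframe and the coframe [dr_i] *)

Section StructureEquations.
Context {R : realType}.
Notation V := 'rV[R]_5.
Implicit Types p u v : V.

Definition lc (a b c s w : R) : V -> V -> R := fun p v =>
  a * fa p v + b * fb p v + c * fc p v + s * fs p v + w * fw p v.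

Lemma frame_elementary v :
  [/\ elementary (fun p => fa p v), elementary (fun p => fb p v),
      elementary (fun p => fc p v), elementary (fun p => fs p v) &
      elementary (fun p => fw p v)].
Proof. by split; rewrite /fa /fb /fc /fs /fw; elementary_field. Qed.

Lemma lc_elementary a b c s w v : elementary (fun p => lc a b c s w p v).
Proof.
have [ea eb ec es ew] := frame_elementary v.
exact: elementaryD (elementaryD (elementaryD (elementaryD (elementaryZ ea)
  (elementaryZ eb)) (elementaryZ ec)) (elementaryZ es)) (elementaryZ ew).
Qed.

Lemma lc_linear a b c s w p k u v :
  lc a b c s w p (k *: u + v) = k * lc a b c s w p u + lc a b c s w p v.
Proof.
have [Ea Eb Ec Es Ew] := frame_linear p k u v.
by rewrite /lc Ea Eb Ec Es Ew; ring.
Qed.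

Lemma lc_form1 a b c s w : is_form1 (lc a b c s w).
Proof.
split=> [p k u v|v]; first exact: lc_linear.
exact/elementary_smooth/lc_elementary.
Qed.

Lemma extd_frame p u v :
  [/\ extd fa p u v = 0,
      extd fb p u v = wedge fa fb p u v,
      extd fc p u v = wedge fw fs p u v + wedge fb fs p u v,
      extd fs p u v = - (wedge fw fc p u v + wedge fb fc p u v) &
      extd fw p u v = 9 * wedge fc fs p u v - wedge fa fb p u v].
Proof.
have cs := cos2sin2 (psi p).
split; rewrite /extd /wedge /fa /fb /fc /fs /fw; do 2!derive_field;
  move: cs; rewrite /theta /phi /x /q /psi => cs; by ring: cs.
Qed.

Lemma extd_lc a b c s w p u v : extd (lc a b c s w) p u v =
  a * extd fa p u v + b * extd fb p u v + c * extd fc p u v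
  + s * extd fs p u v + w * extd fw p u v.
Proof.
have dlc k l : 'D_k (lc a b c s w ^~ l) p = a * 'D_k (fa ^~ l) p
    + b * 'D_k (fb ^~ l) p + c * 'D_k (fc ^~ l) p + s * 'D_k (fs ^~ l) p
    + w * 'D_k (fw ^~ l) p.
  have [ea eb ec es ew] := frame_elementary l.
  have eab := elementaryD (@elementaryZ _ a _ ea) (@elementaryZ _ b _ eb).
  have eabc := elementaryD eab (@elementaryZ _ c _ ec).
  have eabcs := elementaryD eabc (@elementaryZ _ s _ es).
  rewrite (elementary_dD _ _ _ _ eabcs (elementaryZ ew)).
  rewrite (elementary_dD _ _ _ _ eabc (elementaryZ es)).
  rewrite (elementary_dD _ _ _ _ eab (elementaryZ ec)).
  rewrite (elementary_dD _ _ _ _ (elementaryZ ea) (elementaryZ eb)).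
  by rewrite !elementary_dZ.
by rewrite /extd !dlc; ring.
Qed.

Lemma rollingP p v : rolling p v <->
  [/\ fa p v = fc p v, fb p v = fs p v & fw p v = 0].
Proof.
rewrite /rolling /ker3 omega1E omega2E omega3E.
by split=> -[/eqP + /eqP + ->]; rewrite ?subr_eq0 => /eqP -> /eqP ->; split=> //;
  rewrite subrr.
Qed.

Lemma gtilde_nurowski : nurowski_metric (@rolling R) (@gtilde R).
Proof.
(* The first two forms are [omega1] and [omega2]. The factorisation [fa^2 + 2 fa fc - 3 fc^2 = (fa -
   fc)(fa + 3 fc)] and its analogue for [fb], [fs] then give the fifth form and, up to sign, the
   fourth. With factor 1/2, the weight 1/6 of [fw] forces [omega3 / 2] up to sign. *)
exists (lc 1 0 (-1) 0 0), (lc 0 1 0 (-1) 0), (lc 0 0 0 0 (1 / 2)),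
  (lc 0 (- (1 / 2)) 0 (- (3 / 2)) 0), (lc (1 / 2) 0 (3 / 2) 0 0), (fun=> 1 / 2).
split.
- split.
    split; first by split; exact: lc_form1.
    move=> p v; rewrite /lc => E1 E2 E3 E4 E5.
    rewrite -(vec_frame p v).
    have -> : fa p v = 0 by lra.
    have -> : fb p v = 0 by lra.
    have -> : fc p v = 0 by lra.
    have -> : fs p v = 0 by lra.
    have -> : fw p v = 0 by lra.
    exact: vec0.
  (* The connection forms have constant coefficients: [O1 = O4 = 0], [O3 = - O2], and [O5], [O6],
     [O7] are 3/4 of the fourth, fifth and third coframe forms. *)
  exists (lc 0 0 0 0 0), (lc 0 (-1) 0 0 (- (1 / 4))), (lc 0 1 0 0 (1 / 4)),
    (lc 0 0 0 0 0), (lc 0 (- (3 / 8)) 0 (- (9 / 8)) 0),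
    (lc (3 / 8) 0 (9 / 8) 0 0), (lc 0 0 0 0 (3 / 8)).
  split; first by split; exact: lc_form1.
  split; first by split; exact: lc_form1.
  move=> p u v; rewrite !extd_lc.
  have [-> -> -> -> ->] := extd_frame p u v.
  have addE (a b : V -> V -> R) w : (a + b) p w = a p w + b p w by [].
  have dblE (a : V -> V -> R) w : (a *+ 2) p w = a p w + a p w by [].
  rewrite /wedge !(addE, dblE) /lc.
  move: (fa p u) (fb p u) (fc p u) (fs p u) (fw p u) => a b e f g.
  move: (fa p v) (fb p v) (fc p v) (fs p v) (fw p v) => a' b' e' f' g'.
  by split; field.
- move=> p v; rewrite rollingP /ker3 /lc.
  by split=> -[E1 E2 E3]; split; lra.
- exact/elementary_smooth/elementary_cst.
- by move=> p; lra.
- move=> p u v; rewrite gtildeE /symprod /lc; by field.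
Qed.

(** A vector killed by all five [dr_i] lies in the radical of [ds2], which is a positive multiple of
    the nondegenerate [gtilde]. *)
Lemma r_coframe :
  coframe (d (@r1 R)) (d (@r2 R)) (d (@r3 R)) (d (@r4 R)) (d (@r5 R)).
Proof.
have form f : elementary f -> is_form1 (@d R f).
  move=> ef; split=> [p k u v|v].
    have df := elementary_diff p ef.
    by rewrite /d linearD linearZ.
  apply: elementary_smooth.
  by under eq_fun do rewrite dE //; exact: elementary_derive.
split.
  split; apply: form.
  - exact: r1_elementary.
  - exact: r2_elementary.
  - exact: r3_elementary.
  - exact: r4_elementary.
  - exact: r5_elementary.
move=> p v E1 E2 E3 E4 E5; apply: (gtilde_nondegenerate p) => u.
have := ds2_gtilde p u v; rewrite /ds2 /symprod E1 E2 E3 E4 E5.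
rewrite !(mulr0, mul0r, addr0) => /esym/eqP.
rewrite mulf_eq0 => /orP[|/eqP //].
by rewrite gt_eqF // mulr_gt0 ?expR_gt0 // divr_gt0.
Qed.

End StructureEquations.

(** * Brackets of vector fields through exterior derivatives *)

Section Rank235.
Context {R : realType}.
Notation V := 'rV[R]_5.
Implicit Types p u v : V.

(** Leibniz rule for the pairing of a 1-form with a vector field. Sections of a distribution are
    arbitrary smooth fields, so [Y] is only taken differentiable at [p], while the form is
    elementary. *)
Lemma derive_form (al : V -> V -> R) (Y : V -> V) p w :
  (forall p k u v, al p (k *: u + v) = k * al p u + al p v) ->
  (forall v, elementary (al ^~ v)) ->
  (forall i, differentiable (fun p => Y p ord0 i) p) ->
  'D_w (fun p => al p (Y p)) p = 'D_w (al ^~ (Y p)) p + al p ('D_w Y p).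
Proof.
move=> lal eal dY; pose e i : V := delta_mx ord0 i.
have dYi i : derivable (fun p => Y p ord0 i) p w by exact: diff_derivable.
have dal i : derivable (al ^~ (e i)) p w by exact: elementary_derivable.
have -> : (fun p => al p (Y p)) =
    \sum_(i < 5) ((fun p => Y p ord0 i) * (al ^~ (e i))).
  by apply/funext => p'; rewrite fct_sumE; exact: linear_sum_delta.
rewrite derive_sum => [|i]; last exact: derivableM.
have -> : al ^~ (Y p) = fun p' => \sum_i Y p ord0 i * al p' (e i).
  by apply/funext => p'; exact: linear_sum_delta.
rewrite elementary_dsum => [|i]; last exact: elementaryZ.
rewrite (linear_sum_delta (al p)) // -big_split /=; apply: eq_bigr => i _.
have dYm : derivable Y p w.
  by apply/derivable_mxP => a b; rewrite (ord1 a).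
rewrite deriveM // elementary_dZ // derive_mx // mxE /GRing.scale /=.
by rewrite [_ * al _ _]mulrC.
Qed.

(** Cartan's formula for the exterior derivative, solved for the bracket. *)
Lemma form_bracket (al : V -> V -> R) (X Y : V -> V) p :
  (forall p k u v, al p (k *: u + v) = k * al p u + al p v) ->
  (forall v, elementary (al ^~ v)) ->
  (forall i, smooth (fun p => X p ord0 i)) ->
  (forall i, smooth (fun p => Y p ord0 i)) ->
  al p (bracket X Y p) = 'D_(X p) (fun p => al p (Y p)) p
    - 'D_(Y p) (fun p => al p (X p)) p - extd al p (X p) (Y p).
Proof.
move=> lal eal sX sY.
rewrite (derive_form al Y p (X p) lal eal (fun i => sY i [::] p)).
rewrite (derive_form al X p (Y p) lal eal (fun i => sX i [::] p)).
by rewrite /extd /bracket -scaleN1r addrC lal; ring.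
Qed.

(** [[E, f E'] = f [E, E'] + (E f) E'] for fields with constant frame coefficients; the coefficients
    of [[E, E']] are minus the structure equations evaluated on [E] and [E']. *)
Lemma bracket_vec (a b c s w a' b' c' s' w' : R) (f : V -> R) p : elementary f ->
  bracket (fun p => vec p a b c s w) (fun p => f p *: vec p a' b' c' s' w') p =
  f p *: vec p 0 (b * a' - a * b') ((w' + b') * s - (w + b) * s')
    ((w + b) * c' - (w' + b') * c) (a * b' - b * a' - 9 * (c * s' - s * c'))
  + 'D_(vec p a b c s w) f p *: vec p a' b' c' s' w'.
Proof.
move=> ef; set X := fun p => _; set Y := fun p => f p *: _.
have ev a0 b0 c0 s0 w0 : mx_elementary (fun p => vec p a0 b0 c0 s0 w0).
  by apply: vec_elementary; exact: elementary_cst.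
have eX i : smooth (fun p => X p ord0 i) by apply: elementary_smooth; exact: ev.
have eY i : smooth (fun p => Y p ord0 i).
  by apply: elementary_smooth; exact: (mx_elementaryZ ef (ev _ _ _ _ _)).
have B k1 k2 k3 k4 k5 : lc k1 k2 k3 k4 k5 p (bracket X Y p) =
    'D_(X p) f p * (k1 * a' + k2 * b' + k3 * c' + k4 * s' + k5 * w')
    - f p * extd (lc k1 k2 k3 k4 k5) p (X p) (vec p a' b' c' s' w').
  rewrite form_bracket //; [|exact: lc_linear|exact: lc_elementary].
  have -> : (fun p => lc k1 k2 k3 k4 k5 p (Y p)) = fun p =>
      (k1 * a' + k2 * b' + k3 * c' + k4 * s' + k5 * w') * f p.
    by apply/funext => p'; rewrite /Y vec_scale /lc !vecE; ring.
  have -> : (fun p => lc k1 k2 k3 k4 k5 p (X p)) = fun=>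
      k1 * a + k2 * b + k3 * c + k4 * s + k5 * w.
    by apply/funext => p'; rewrite /X /lc !vecE.
  rewrite elementary_dZ // derive_cst subr0 mulrC; congr (_ - _).
  rewrite /Y !extd_lc.
  have [-> -> -> -> ->] := extd_frame p (X p) (f p *: vec p a' b' c' s' w').
  have [-> -> -> -> ->] := extd_frame p (X p) (vec p a' b' c' s' w').
  by rewrite vec_scale /wedge !vecE; ring.
rewrite vec_scale vec_scale vec_add -[LHS](vec_frame p).
have E k1 k2 k3 k4 k5 v : lc k1 k2 k3 k4 k5 p v = k1 * fa p v + k2 * fb p v
  + k3 * fc p v + k4 * fs p v + k5 * fw p v by [].
have [e1 e2 e3 e4 e5] := extd_frame p (X p) (vec p a' b' c' s' w').
congr (vec p _ _ _ _ _).
- have := B 1 0 0 0 0; rewrite extd_lc e1 E !(mul1r, mul0r, addr0, add0r) => ->; ring.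
- have := B 0 1 0 0 0; rewrite extd_lc e2 E !(mul1r, mul0r, addr0, add0r) => ->.
  by rewrite /wedge /X !vecE; ring.
- have := B 0 0 1 0 0; rewrite extd_lc e3 E !(mul1r, mul0r, addr0, add0r) => ->.
  by rewrite /wedge /X !vecE; ring.
- have := B 0 0 0 1 0; rewrite extd_lc e4 E !(mul1r, mul0r, addr0, add0r) => ->.
  by rewrite /wedge /X !vecE; ring.
- have := B 0 0 0 0 1; rewrite extd_lc e5 E !(mul1r, mul0r, addr0, add0r) => ->.
  by rewrite /wedge /X !vecE; ring.
Qed.

End Rank235.

(** * The growth vector (2,3,5) of the rolling distribution *)

Section Growth235.
Context {R : realType}.
Notation V := 'rV[R]_5.
Implicit Types p u v : V.

Lemma section_vec (D : V -> V -> Prop) (a b c s w : R) (f : V -> R) :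
  elementary f ->
  (forall p k, D p (k *: vec p a b c s w)) ->
  section_of D (fun p => f p *: vec p a b c s w).
Proof.
move=> ef Dv; split=> [i|p]; last exact: Dv.
apply: elementary_smooth; apply: mx_elementaryZ => //.
by apply: vec_elementary; exact: elementary_cst.
Qed.

Lemma section_vec1 (D : V -> V -> Prop) (a b c s w : R) :
  (forall p k, D p (k *: vec p a b c s w)) ->
  section_of D (fun p => vec p a b c s w).
Proof.
move=> Dv; have := section_vec D a b c s w (fun=> 1) (elementary_cst 1) Dv.
by under eq_fun do rewrite scale1r.
Qed.

Lemma rolling_vec p k a b : rolling p (k *: vec p a b a b 0).
Proof. by rewrite rollingP vec_scale !vecE mulr0. Qed.

Lemma derive_theta_vec a b c s w p : 'D_(vec p a b c s w) (@theta R) p = a.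
Proof. by rewrite -dE; [rewrite d_theta /vec mkvE | elementary_field]. Qed.

Lemma derive_phi_vec a b c s w p :
  'D_(vec p a b c s w) (@phi R) p = expR (- theta p) * b.
Proof. by rewrite -dE; [rewrite d_phi /vec mkvE | elementary_field]. Qed.

(* Write Y1 = vec 1 0 1 0 0 and Y2 = vec 0 1 0 1 0.  Besides [Y1, Y2], the
   brackets [Y1, theta Y2] and [Y2, phi Y1] bring Y2 and Y1 into the span. *)
Lemma bracket_generators (D : V -> V -> Prop) p (M : 'M[R]_5) :
  (forall p v, rolling p v -> D p v) ->
  (forall X Y, section_of D X -> section_of (@rolling R) Y ->
    (bracket X Y p <= M)%MS) ->
  [/\ (vec p 1 0 1 0 0 <= M)%MS, (vec p 0 1 0 1 0 <= M)%MS &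
      (vec p 0 (-1) 0 (-1) (-8) <= M)%MS].
Proof.
move=> rD BM.
have e1 := elementary_cst (1 : R).
have eth : elementary (@theta R) by elementary_field.
have eph : elementary (@phi R) by elementary_field.
have sr a b : section_of D (fun p => vec p a b a b 0).
  by apply: section_vec1 => p' k; apply: rD; exact: rolling_vec.
have sY a b f : elementary f ->
    section_of (@rolling R) (fun p => f p *: vec p a b a b 0).
  by move=> ef; apply: section_vec => // p' k; exact: rolling_vec.
(* This is [[Y1, Y2]]. Its last coefficient is [1 - 9], nonzero because the two curvatures
   differ. *)
have Z : (vec p 0 (-1) 0 (-1) (-8) <= M)%MS.
  have := BM _ _ (sr 1 0) (sY 0 1 _ e1).
  rewrite bracket_vec // derive_cst scale0r addr0 scale1r.
  by congr (vec _ _ _ _ _ _ <= _)%MS; ring.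
split=> //.
- have := BM _ _ (sr 0 1) (sY 1 0 _ eph).
  rewrite bracket_vec // derive_phi_vec.
  set Z' := vec p _ _ _ _ _.
  have -> : Z' = - vec p 0 (-1) 0 (-1) (-8).
    by rewrite -scaleN1r vec_scale; congr (vec _ _ _ _ _ _); ring.
  move=> H; have ZM : (phi p *: - vec p 0 (-1) 0 (-1) (-8) <= M)%MS.
    by rewrite scalemx_sub // eqmx_opp.
  have := addmx_sub H (_ : (- (phi p *: - vec p 0 (-1) 0 (-1) (-8)) <= M)%MS).
  rewrite eqmx_opp => /(_ ZM); rewrite addrAC subrr add0r.
  (* The derivative of [phi] along [Y2] is [expR (- theta p)], which this factor undoes. *)
  move=> /(scalemx_sub (expR (theta p))).
  by rewrite scalerA mulr1 -expRD subrr expR0 scale1r.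
- have := BM _ _ (sr 1 0) (sY 0 1 _ eth).
  rewrite bracket_vec // derive_theta_vec scale1r.
  set Z' := vec p _ _ _ _ _.
  have -> : Z' = vec p 0 (-1) 0 (-1) (-8).
    by congr (vec _ _ _ _ _ _); ring.
  move=> H; have ZM : (- (theta p *: vec p 0 (-1) 0 (-1) (-8)) <= M)%MS.
    by rewrite eqmx_opp scalemx_sub.
  by have := addmx_sub H ZM; rewrite addrAC subrr add0r.
Qed.

(** By Cartan's formula: [omega1] and [omega2] vanish identically on both sections, and their
    exterior derivatives vanish on the rolling planes. *)
Lemma bracket_rolling_kernel X Y p :
  section_of (@rolling R) X -> section_of (@rolling R) Y ->
  lc 1 0 (-1) 0 0 p (bracket X Y p) = 0 /\ lc 0 1 0 (-1) 0 p (bracket X Y p) = 0.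
Proof.
move=> [sX rX] [sY rY].
have lcK Z : (forall p, rolling p (Z p)) ->
    (forall p, lc 1 0 (-1) 0 0 p (Z p) = 0) /\
    (forall p, lc 0 1 0 (-1) 0 p (Z p) = 0).
  move=> rZ; split=> p'; have /rollingP[E1 E2 E3] := rZ p'; rewrite /lc E1 E2 E3;
  by ring.
have [X1 X2] := lcK _ rX; have [Y1 Y2] := lcK _ rY.
have /rollingP[a1 a2 a3] := rX p; have /rollingP[b1 b2 b3] := rY p.
have [e1 e2 e3 e4 e5] := extd_frame p (X p) (Y p).
split.
- rewrite (form_bracket _ X Y p (lc_linear 1 0 (-1) 0 0)
    (lc_elementary 1 0 (-1) 0 0) sX sY).
  have -> : (fun p => lc 1 0 (-1) 0 0 p (Y p)) = fun=> 0 by exact/funext/Y1.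
  have -> : (fun p => lc 1 0 (-1) 0 0 p (X p)) = fun=> 0 by exact/funext/X1.
  rewrite !derive_cst extd_lc e1 e2 e3 e4 e5 /wedge a1 a2 a3 b1 b2 b3; ring.
- rewrite (form_bracket _ X Y p (lc_linear 0 1 0 (-1) 0)
    (lc_elementary 0 1 0 (-1) 0) sX sY).
  have -> : (fun p => lc 0 1 0 (-1) 0 p (Y p)) = fun=> 0 by exact/funext/Y2.
  have -> : (fun p => lc 0 1 0 (-1) 0 p (X p)) = fun=> 0 by exact/funext/X2.
  rewrite !derive_cst extd_lc e1 e2 e3 e4 e5 /wedge a1 a2 a3 b1 b2 b3; ring.
Qed.

Lemma derived_rollingP p v : bracket_dist (@rolling R) (@rolling R) p v <->
  fa p v = fc p v /\ fb p v = fs p v.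
Proof.
split=> [Bv|[E1 E2] M BM].
  (* Upper bound: the span is tested on the row space [kermx N], the common kernel of [omega1] and
     [omega2] at [p]. *)
  pose N : 'M[R]_(5, 2) := \matrix_(i, k) if k == ord0
    then lc 1 0 (-1) 0 0 p (delta_mx ord0 i) else lc 0 1 0 (-1) 0 p (delta_mx ord0 i).
  have NE u : (u <= kermx N)%MS <->
      lc 1 0 (-1) 0 0 p u = 0 /\ lc 0 1 0 (-1) 0 p u = 0.
    have uN k : (u *m N) ord0 k =
        if k == ord0 then lc 1 0 (-1) 0 0 p u else lc 0 1 0 (-1) 0 p u.
      rewrite mxE; case: ifP => k0; rewrite [RHS]linear_sum_delta;
        try exact: lc_linear; by apply: eq_bigr => i _; rewrite mxE k0.
    split=> [/sub_kermxP uN0|[u1 u2]].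
      by split; [have := uN ord0 | have := uN ord_max]; rewrite uN0 mxE.
    by apply/sub_kermxP/rowP => k; rewrite uN mxE; case: ifP.
  have /NE : (v <= kermx N)%MS.
    by apply: Bv => X Y sX sY; apply/NE; exact: bracket_rolling_kernel.
  by rewrite /lc => -[H1 H2]; split; lra.
(* Lower bound: any admissible [M] contains three vectors spanning that kernel. *)
have [M1 M2 M3] := bracket_generators _ p M (fun _ _ => id) BM.
have -> : v = fa p v *: vec p 1 0 1 0 0
    + ((fb p v - fw p v / 8) *: vec p 0 1 0 1 0
    + (- (fw p v / 8)) *: vec p 0 (-1) 0 (-1) (-8)).
  rewrite 3!vec_scale !vec_add -[LHS](vec_frame p) -E1 -E2.
  by congr (vec p _ _ _ _ _); field.
by do 2?apply: addmx_sub; exact: scalemx_sub.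
Qed.

Lemma has_rank_rows (D : V -> V -> Prop) k (B : V -> 'I_k -> V) :
  (forall p (c : 'I_k -> R), \sum_i c i *: B p i = 0 -> forall i, c i = 0) ->
  (forall p v, D p v <-> exists c : 'I_k -> R, v = \sum_i c i *: B p i) ->
  has_rank D k.
Proof.
move=> free DP p; exists (\matrix_(i < k) B p i).
have mulE (c : 'rV[R]_k) : c *m \matrix_(i < k) B p i = \sum_i c ord0 i *: B p i.
  by rewrite mulmx_sum_row; apply: eq_bigr => i _; rewrite rowK.
split.
  rewrite -kermx_eq0; apply/rowV0P => c /sub_kermxP; rewrite mulE => c0.
  by apply/rowP => i; rewrite (free p (c ord0) c0) mxE.
move=> v; rewrite DP; split=> [[c ->]|/submxP[c ->]].
  have -> : \sum_i c i *: B p i = (\row_i c i) *m \matrix_(i < k) B p i.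
    by rewrite mulE; apply: eq_bigr => i _; rewrite mxE.
  exact: submxMl.
by exists (c ord0); rewrite mulE.
Qed.

Lemma rolling_rank : has_rank (@rolling R) 2.
Proof.
apply: (has_rank_rows _ _ (fun p i =>
  if i == ord0 then vec p 1 0 1 0 0 else vec p 0 1 0 1 0)) => p.
  move=> c; rewrite big_ord_recl big_ord1 /= !vec_scale vec_add -(vec0 p) => E.
  have := congr1 (fa p) E; rewrite !vecE => Ea.
  have := congr1 (fb p) E; rewrite !vecE => Eb.
  move=> -[[|[|//]] lti].
    by rewrite [LHS](_ : _ = c ord0); [lra | congr (c _); exact: val_inj].
  by rewrite [LHS](_ : _ = c (lift ord0 ord0)); [lra | congr (c _); exact: val_inj].
move=> v; rewrite rollingP; split=> [[E1 E2 E3]|[c ->]].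
  exists (fun i => if i == ord0 then fa p v else fb p v).
  rewrite big_ord_recl big_ord1 /= !vec_scale vec_add -[LHS](vec_frame p).
  by rewrite -E1 -E2 E3; congr (vec p _ _ _ _ _); ring.
rewrite big_ord_recl big_ord1 /= !vec_scale vec_add !vecE.
by split; ring.
Qed.

Lemma derived_rolling_rank : has_rank (bracket_dist (@rolling R) (@rolling R)) 3.
Proof.
apply: (has_rank_rows _ _ (fun p (i : 'I_3) =>
  [:: vec p 1 0 1 0 0; vec p 0 1 0 1 0; vec p 0 0 0 0 1]`_i)) => p.
  move=> c; rewrite !big_ord_recl big_ord0 addr0 /= !vec_scale !vec_add -(vec0 p) => E.
  have := congr1 (fa p) E; rewrite !vecE => Ea.
  have := congr1 (fb p) E; rewrite !vecE => Eb.
  have := congr1 (fw p) E; rewrite !vecE => Ew.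
  move=> -[[|[|[|//]]] lti].
  - by rewrite [LHS](_ : _ = c ord0); [lra | congr (c _); exact: val_inj].
  - by rewrite [LHS](_ : _ = c (lift ord0 ord0)); [lra | congr (c _); exact: val_inj].
  - by rewrite [LHS](_ : _ = c (lift ord0 (lift ord0 ord0)));
      [lra | congr (c _); exact: val_inj].
move=> v; rewrite derived_rollingP; split=> [[E1 E2]|[c ->]].
  exists (fun i => [:: fa p v; fb p v; fw p v]`_i).
  rewrite !big_ord_recl big_ord0 addr0 /= !vec_scale !vec_add -[LHS](vec_frame p).
  by rewrite -E1 -E2; congr (vec p _ _ _ _ _); ring.
rewrite !big_ord_recl big_ord0 addr0 /= !vec_scale !vec_add !vecE.
by split; ring.
Qed.

Lemma rolling_235 : is_235 (@rolling R).
Proof.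
split; [exact: rolling_rank|exact: derived_rolling_rank|move=> p v M BM].
have [M1 M2 M3] : [/\ (vec p 1 0 1 0 0 <= M)%MS, (vec p 0 1 0 1 0 <= M)%MS &
    (vec p 0 (-1) 0 (-1) (-8) <= M)%MS].
  apply: bracket_generators BM => p' u /rollingP[E1 E2 _].
  exact/derived_rollingP.
have sZ : section_of (bracket_dist (@rolling R) (@rolling R))
    (fun p => vec p 0 (-1) 0 (-1) (-8)).
  by apply: section_vec1 => p' k; apply/derived_rollingP; rewrite vec_scale !vecE.
have sY a b : section_of (@rolling R) (fun p => 1 *: vec p a b a b 0).
  apply: (section_vec _ _ _ _ _ _ (fun=> 1)) => [|p' k]; first exact: elementary_cst.
  exact: rolling_vec.
(* These brackets are [vec p 0 (-1) 0 (-9) (-8)] and [vec p 0 0 8 0 0]. Subtracting [[Y1, Y2]] from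
   the first leaves [vec p 0 0 0 (-8) 0], so they supply the two directions transverse to the
   derived distribution. *)
have M4 := BM _ _ sZ (sY 1 0).
have M5 := BM _ _ sZ (sY 0 1).
move: M4 M5; rewrite !(bracket_vec _ _ _ _ _ _ _ _ _ _ (fun=> 1) p (elementary_cst 1)).
rewrite !derive_cst !scale0r !addr0 !scale1r => M4 M5.
set W4 := vec p _ _ _ _ _ in M4; set W5 := vec p _ _ _ _ _ in M5.
have -> : v = fa p v *: vec p 1 0 1 0 0
    + ((fb p v - fw p v / 8) *: vec p 0 1 0 1 0
    + ((- (fw p v / 8) - (fb p v - fs p v) / 8) *: vec p 0 (-1) 0 (-1) (-8)
    + (((fb p v - fs p v) / 8) *: W4 + ((fc p v - fa p v) / 8) *: W5))).
  rewrite !vec_scale !vec_add -[LHS](vec_frame p).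
  by congr (vec p _ _ _ _ _); field.
by do 4?apply: addmx_sub; exact: scalemx_sub.
Qed.

End Growth235.

Theorem proposition3p4 (R : realType) :
  [/\ is_235 (@rolling R),
      nurowski_metric (@rolling R) (@gtilde R),
      weyl_flat (@gtilde R),
      [/\ smooth (@r1 R), smooth (@r2 R), smooth (@r3 R), smooth (@r4 R)
        & smooth (@r5 R)] /\
      coframe (d (@r1 R)) (d (@r2 R)) (d (@r3 R)) (d (@r4 R)) (d (@r5 R)) &
      forall p u v : 'rV[R]_5,
        ds2 p u v = 1 / 6 * expR (- 2 * theta p) * gtilde p u v].
Proof.
split.
- exact: rolling_235.
- exact: gtilde_nurowski.
- exact: gtilde_weyl_flat.
- split; last exact: r_coframe.
  split; apply: elementary_smooth.
  + exact: r1_elementary.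
  + exact: r2_elementary.
  + exact: r3_elementary.
  + exact: r4_elementary.
  + exact: r5_elementary.
- exact: ds2_gtilde.
Qed.
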